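(* Under the hierarchical sampling setup and supersample construction described in the context, assume the loss is $\lambda$-Lipschitz in its first argument: $|\ell(w,z)-\ell(w',z)|\le\lambda\,\rho(w,w')$ for all $w,w'\in\mathcal W$, $z\in\mathcal Z$. Then $$\mathrm{gen}(P_{W\mid\mu})\le 2\lambda\sum_{l=1}^{L}\frac{1}{N_l}\sum_{i_{1:l}}\Big|\mathbb{E}_{\tilde\mu_l^{i_{1:l}},\,U_l^{i_{1:l}}}\,\mathbb{W}\Big(P_{W\mid\tilde\mu_l^{i_{1:l}},U_l^{i_{1:l}}},\,P_{W\mid\tilde\mu_l^{i_{1:l}}}\Big)\Big|,$$ where $\mathbb{W}$ is the Wasserstein-1 distance on $(\mathcal W,\rho)$.
   Context: Hierarchical sampling setup. Fix integers $L\ge 1$ (the depth) and branching factors $n_1,\dots,n_L\ge 1$; set $N_0=1$ and $N_l=\prod_{k=1}^l n_k$. Nodes at depth $l\in\{1,\dots,L\}$ are indexed by $i_{1:l}=(i_1,\dots,i_l)$ with $i_k\in\{1,\dots,n_k\}$. Let $\mathcal Z$ be a measurable data space. Let $\mathcal P_L=\mathcal Z$ and, for $0\le l<L$, let $\mathcal P_l$ be the set of probability measures on $\mathcal P_{l+1}$. A fixed meta-distribution $D\in\mathcal P_0$ is given. The random tree $\mu=(\mu_l^{i_{1:l}})$: $\mu_1^{i_1}$ i.i.d. $D$; for $l\ge2$, conditionally on depths $<l$, the $\mu_l^{i_{1:l}}$ are independent with $\mu_l^{i_{1:l}}\sim\mu_{l-1}^{i_{1:l-1}}$; leaves $\mu_L^{i_{1:L}}\in\mathcal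 Z$ are data points. For $\nu\in\mathcal P_l$, ''$Z\sim\nu$'' means drawing $\nu_{l+1}\sim\nu,\dots,\nu_L\sim\nu_{L-1}$ with fresh randomness and setting $Z=\nu_L$. $(\mathcal W,\rho)$ is a metric hypothesis space, $\ell:\mathcal W\times\mathcal Z\to\mathbb R$ a measurable loss, $P_{W\mid\mu}$ a Markov kernel from the tree to $\mathcal W$. $\hat L(w,\mu)=\frac1{N_L}\sum_{i_{1:L}}\ell(w,\mu_L^{i_{1:L}})$, $L(w)=\mathbb{E}_{Z\sim D}\ell(w,Z)$, $\mathrm{gen}(P_{W\mid\mu})=\mathbb{E}[L(W)-\hat L(W,\mu)]$. Supersample construction. For every depth $l\ge1$ and index $i_{1:l}$ let $U_l^{i_{1:l}}$ be uniform on $\{1,2\}$, all mutually independent and independent of everything else. At depth 1, $\tilde\mu_1^{i_1}=(\mu_{1,1}^{i_1},\mu_{1,2}^{i_1})\sim D^{\otimes2}$ independently over $i_1$. For $l\ge2$, conditionally on all depths $<l$, $\tilde\mu_l^{i_{1:l}}=(\mu_{l,1}^{i_{1:l}},\mu_{l,2}^{i_{1:l}})$ are two independent draws from the selected parent $\mu_{l-1}^{i_{1:l-1}}:=\mu_{l-1,U_{l-1}^{i_{1:l-1}}}^{i_{1:l-1}}$, independently over nodes. The selected node is $\mu_l^{i_{1:l}}:=\mu_{l,U_l^{i_{1:l}}}^{i_{1:l}}$ and the ghost node is $\bar\mu_l^{i_{1:l}}:=\mu_{l,3-U_l^{i_{1:l}}}^{i_{1:l}}$. The selected nodes form a tree with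 the same law as the hierarchical tree, and $W\sim P_{W\mid\mu}$ is computed from this selected tree. $P_{W\mid\tilde\mu_l^{i_{1:l}},U_l^{i_{1:l}}}$ and $P_{W\mid\tilde\mu_l^{i_{1:l}}}$ denote the conditional laws of $W$ given $(\tilde\mu_l^{i_{1:l}},U_l^{i_{1:l}})$ and given $\tilde\mu_l^{i_{1:l}}$ respectively. *)

(* Defs.v *)
From HB Require Import structures.
From mathcomp Require Import all_boot all_order all_algebra.
From mathcomp Require Import all_classical all_reals all_analysis.

Set Implicit Arguments.
Unset Strict Implicit.
Unset Printing Implicit Defensive.

Import Order.TTheory GRing.Theory Num.Def Num.Theory.

Local Open Scope classical_set_scope.
Local Open Scope ring_scope.

(* Conventions:
   - levels are indexed by their HEIGHT h = L - l (l = depth); the level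
     space at height h is [Lt h]:  Lt 0 = Z,  Lt (h+1) = probability measures
     on Lt h (with the library's sigma-algebra [pprobability]).  Hence
     P_l = Lt (L - l), and D : Lt L.
   - branching factors are a function n : nat -> nat (n k for k = 1..L),
     N l = n 1 * ... * n l.
   - the nodes i_{1:l} at depth l are encoded (mixed radix) by the naturals
     j < N l: (i_1,...,i_l) |-> sum_k (i_k - 1) * n_{k+1} * ... * n_l;
     the children of node j at depth l are j * n_{l+1} + r, r < n_{l+1}.
   - the two supersample copies are indexed by b : bool (false = copy 1,
     true = copy 2), and U : bool likewise (U = false means U = 1). *)

Section Defs.
Variables (R : realType) (dZ : measure_display) (Z : measurableType dZ).

Fixpoint Lev (h : nat) : {d : measure_display & measurableType d} :=
  match h with
  | 0 => existT _ dZ Z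
  | h'.+1 => existT _ _ (pprobability (projT2 (Lev h')) R)
  end.

Definition Lt (h : nat) : measurableType (projT1 (Lev h)) := projT2 (Lev h).

Definition Nl (n : nat -> nat) (l : nat) : nat := (\prod_(1 <= k < l.+1) n k)%N.

Definition relevant (L : nat) (n : nat -> nat) (h j : nat) : Prop :=
  (h < L)%N /\ (j < Nl n (L - h))%N.

(* a (selected) tree: a value at every node; only relevant nodes matter *)
Definition Tree : Type := forall h : nat, nat -> Lt h.
HB.instance Definition _ := gen_eqMixin Tree.
HB.instance Definition _ := gen_choiceMixin Tree.
HB.instance Definition _ := isPointed.Build Tree (fun h _ => point).

Definition treeG (L : nat) (n : nat -> nat) : set (set Tree) :=
  [set A | exists h j, relevant L n h j /\
     exists B : set (Lt h), measurable B /\ A = (fun t : Tree => t h j) @^-1` B].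

Definition TreeM (L : nat) (n : nat -> nat) := g_sigma_algebraType (treeG L n).

Fixpoint Ehier (h : nat) : Lt h -> (Z -> \bar R) -> \bar R :=
  match h with
  | 0 => fun z f => f z
  | h'.+1 => fun nu f => (\int[(nu : probability (Lt h') R)]_y Ehier y f)%E
  end.

(* Law of the supersample on "rectangles": for measurable sets A h j b and
   selection pattern u, [Grect L n A u h j x] is the probability that the
   subtree below node j at height h (whose selected value is x) has
   children-pairs in the sets A and selection variables equal to u, given
   the selection variables are u (the factor 2^-#nodes is added separately). *)
Fixpoint Grect (L : nat) (n : nat -> nat)
  (A : forall h : nat, nat -> bool -> set (Lt h)) (u : nat -> nat -> bool)
  (h : nat) : nat -> Lt h -> \bar R :=
  match h with
  | 0 => fun _ _ => 1%E
  | h'.+1 => fun j x =>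
      (\prod_(r < n (L - h')%N)
        (let c := (j * n (L - h')%N + r)%N in
         \int[(x : probability (Lt h') R)]_(y1 in A h' c false)
          \int[(x : probability (Lt h') R)]_(y2 in A h' c true)
            Grect L n A u c (if u h' c then y2 else y1)))%E
  end.

Definition nnodes (L : nat) (n : nat -> nat) : nat :=
  (\sum_(h < L) Nl n (L - h))%N.

End Defs.

Section Wass.
Variables (R : realType) (dW : measure_display) (W : measurableType dW).
Variable rho : W -> W -> R.

Definition coupling (p q : measure W R) (pi : probability (W * W)%type R) :=
  forall B : set W, measurable B ->
    pi (B `*` setT) = p B /\ pi (setT `*` B) = q B.

Definition wass1 (p q : measure W R) : \bar R :=
  ereal_inf [set (\int[pi]_z (rho z.1 z.2)%:E)%E | pi in coupling p q].

End Wass.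

Section Setup.
Variables (R : realType) (dZ : measure_display) (Z : measurableType dZ).
Variables (dW : measure_display) (Wsp : measurableType dW).
Variables (dO : measure_display) (Om : measurableType dO).

Definition Lpop (L : nat) (D : Lt R Z L) (loss : Wsp -> Z -> R) (w : Wsp) : \bar R :=
  Ehier D (fun z => (loss w z)%:E).

Definition Lhat (L : nat) (n : nat -> nat) (loss : Wsp -> Z -> R)
  (w : Wsp) (t : Tree R Z) : R :=
  (Nl n L)%:R^-1 * \sum_(j < Nl n L) loss w (t 0%N j).

Definition selT (MT : forall h : nat, nat -> bool -> Om -> Lt R Z h)
  (U : nat -> nat -> Om -> bool) (om : Om) : Tree R Z :=
  fun h j => MT h j (U h j om) om.

Definition rectE (L : nat) (n : nat -> nat)
  (MT : forall h : nat, nat -> bool -> Om -> Lt R Z h)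
  (U : nat -> nat -> Om -> bool)
  (A : forall h : nat, nat -> bool -> set (Lt R Z h)) (u : nat -> nat -> bool)
  : set Om :=
  [set om | forall h j, relevant L n h j ->
     (forall b, A h j b (MT h j b om)) /\ U h j om = u h j].

End Setup.

(* Main.v *)
(* Telescoping the gap over the depths reduces it to the terms
   E[E_{Z~parent} l(W,Z) - E_{Z~selected node} l(W,Z)].  Given the selected tree,
   the ghost of a node is drawn from the parent independently of W, so the parent
   may be replaced by the ghost.  Since the selection bit is fair and independent of
   the pair, the corresponding difference with W drawn from P_{W|pair} has mean zero
   and can be subtracted; what remains is at most 2 lambda times a Wasserstein
   distance, by the easy half of Kantorovich duality.

   This needs a bounded loss.  In general only the gap itself is integrable, and
   truncating the values of the loss would not preserve its domination.  Instead the
   recentred loss l(w,z) - l(w0,z) is multiplied by a cutoff depending on w only: the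
   gap is then multiplied by the cutoff, so that dominated convergence applies, and
   for a logarithmic cutoff the Lipschitz constant becomes (1 + e) lambda only. *)

Require Import Defs.
From HB Require Import structures.
From mathcomp Require Import all_boot all_order all_algebra.
From mathcomp Require Import all_classical all_reals all_analysis.
From mathcomp Require Import measurable_realfun lra ring.

Import Order.TTheory GRing.Theory Num.Def Num.Theory.
Import numFieldNormedType.Exports.
Local Open Scope classical_set_scope.
Local Open Scope ring_scope.

(** The law is given only on rectangles with a prescribed selection pattern, as nested integrals
    along the tree, so every conditional law has to be recovered from these. Indexing rectangles by
    role (selected or ghost) makes their probability the same for all patterns, which also yields
    the fairness of the bits. A random factor, such as the mass that the parent gives to a set, does
    not pass through the nested integrals, but a constant lower bound for it does. Hence the law of
    a ghost is first obtained as an inequality tested on constants, and a complement turns it into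
    an equality; pi-systems extend it from rectangles.

    A second obstacle is that [wass1], an infimum over couplings, is not known to be measurable in
    the sample point. Its integral only occurs as an upper bound for measurable functions, where the
    definition of the integral as a supremum over simple functions suffices.

    The weight 1 / N_l comes from counting each parent once per child, which puts two consecutive
    levels over the same denominator. *)

Section generic.
Context {R : realType}.
Local Open Scope ereal_scope.

Lemma finite_measure_eq {d} {T : measurableType d} (G : set (set T))
    (m1 m2 : {measure set T -> \bar R}) :
  measurable = <<s G >> -> setI_closed G -> G setT ->
  (forall A, G A -> m1 A = m2 A) -> m1 setT < +oo ->
  forall A, measurable A -> m1 A = m2 A.
Proof.
move=> mG GI GT m12 m1T A mA.
apply: (@measure_unique _ _ _ G (fun=> setT)) => //.
by apply/seteqP; split => // x _; exists 0%N.
Qed.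

(** A x B is the intersection of the strips A x T2 and T1 x B. As [G1] contains the whole space, T1
    x B is itself a generator, and the strips A x T2 are generated by those with A in [G1]. *)
Lemma measurable_prod_generated {d1 d2} {T1 : measurableType d1}
    {T2 : measurableType d2} (G1 : set (set T1)) :
  measurable = <<s G1 >> -> G1 setT ->
  @measurable _ (T1 * T2)%type = <<s [set A `*` B | A in G1 & B in measurable] >>.
Proof.
move=> mG1 G1T; set G := [set _ | _ in _ & _ in _].
have mG : G `<=` @measurable _ (T1 * T2)%type.
  move=> _ [A GA [B mB <-]]; apply: measurableX => //.
  by rewrite mG1; exact: sub_sigma_algebra.
apply/seteqP; split; last first.
  by apply: smallest_sub => //; exact: sigma_algebra_measurable.
rewrite measurable_prod_measurableType; apply: smallest_sub.
  exact: smallest_sigma_algebra.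
move=> _ [A mA [B mB <-]].
have fst_gen : preimage_set_system setT fst (<<s G1 >>) `<=` <<s G >>.
  rewrite -g_sigma_preimageE; apply: sub_sigma_algebra2.
  move=> _ [A' GA' <-]; exists A' => //; exists setT => //.
  by rewrite setTI; apply/seteqP; split => -[x y] //= [].
rewrite (_ : A `*` B = (setT `&` fst @^-1` A) `&` (setT `&` snd @^-1` B)).
  apply: (@measurableI _ (g_sigma_algebraType G)).
    by apply: fst_gen; exists A => //; rewrite -mG1.
  apply: sub_sigma_algebra; exists setT; first exact: G1T.
  by exists B => //; rewrite setTI; apply/seteqP; split => -[x y] //= [].
by apply/seteqP; split => -[x y] /=; tauto.
Qed.

(** Bundles [pushforward] with the measure structure that depends on [mf]; it stays transparent, so
    that its values unfold to measures of preimages. *)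
Definition image_measure {d d'} {T1 : measurableType d} {T2 : measurableType d'}
  (m : {measure set T1 -> \bar R}) (f : T1 -> T2) (mf : measurable_fun setT f) :
  {measure set T2 -> \bar R}.
Proof. by refine (pushforward m f : {measure set T2 -> \bar R}); exact: mf. Defined.

(* [g] need not be measurable: the integral of a nonnegative function is defined
   as the supremum of the integrals of the simple functions below it. *)
Lemma ge0_le_integralr {d} {T : measurableType d} (m : {measure set T -> \bar R})
    (f g : T -> \bar R) :
  (forall x, 0 <= f x) -> (forall x, f x <= g x) ->
  \int[m]_x f x <= \int[m]_x g x.
Proof.
move=> f0 fg; rewrite !ge0_integralTE//; last by move=> x; exact: le_trans (fg x).
apply: le_ereal_sup => _ [h hf <-]; exists h => // x.
exact: le_trans (hf x) (fg x).
Qed.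

Import HBNNSimple.

(** A simple function below [g] cuts [S] into level sets on which [g] is at least a constant; the
    hypothesis bounds each term, and additivity of [m] sums them. It thus suffices to test the
    density [g] on constants. *)
Lemma integral_density_le {d} {T : measurableType d}
    (q m : {measure set T -> \bar R}) (g : T -> \bar R) (S : set T) :
  measurable S -> (forall x, 0 <= g x) ->
  (forall S' (a : R), measurable S' -> S' `<=` S -> (0 <= a)%R ->
     (forall x, S' x -> a%:E <= g x) -> a%:E * q S' <= m S') ->
  \int[q]_(x in S) g x <= m S.
Proof.
move=> mS g0 qm; rewrite ge0_integralE//; apply: ge_ereal_sup => _ [h hg <-].
rewrite sintegralE.
have mh r : measurable (h @^-1` [set r]) by [].
apply: (@le_trans _ _ (\sum_(r \in range h) m (S `&` h @^-1` [set r]))); last first.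
  rewrite -(@measure_fin_bigcup _ _ _ m _ (range h) (fun r => S `&` h @^-1` [set r])).
  - rewrite -setI_bigcupr; apply: le_measure; rewrite ?inE//.
    by apply: measurableI => //; exact: fin_bigcup_measurable.
  - exact: fimfunP.
  - apply/trivIsetP => i j _ _ /eqP ij; apply/seteqP; split => // x [[_ /= xi] [_ /= xj]].
    by apply: ij; rewrite -xi -xj.
  - by move=> r _; exact: measurableI.
apply: lee_fsum => [|_ [x _ <-]]; first exact: fimfunP.
(* Only the level 0 may leave [S], and its term vanishes. *)
have [hx0|hx0] := eqVneq (h x) 0%R; first by rewrite hx0 mul0e.
have hS : h @^-1` [set h x] `<=` S.
  move=> y /= hy; apply: contrapT => Sy.
  have := hg y; rewrite /= hy patchN ?notin_setE// lee_fin leNgt.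
  by rewrite lt_neqAle eq_sym hx0 /=; have -> : (0 <= h x)%R by [].
rewrite setIidr//; apply: qm => // y /= hy.
by have := hg y; rewrite /= hy patchT ?inE//; exact: hS.
Qed.

(** [E] need not be determined by [X]. Recording membership in [E] as a boolean next to [X] makes it
    a set of the image space, where the previous lemma applies to the images of [P] and of [P]
    restricted to [F]. *)
Lemma integral_density_le_comp {d d'} {Om : measurableType d} {T : measurableType d'}
    (P : {measure set Om -> \bar R}) (X : Om -> T) (E F : set Om) (g : T -> \bar R) :
  measurable_fun setT X -> measurable E -> measurable F -> F `<=` E ->
  (forall x, 0 <= g x) -> measurable_fun setT g ->
  (forall S (a : R), measurable S -> (0 <= a)%R -> (forall x, S x -> a%:E <= g x) ->
     a%:E * P (E `&` X @^-1` S) <= P (F `&` X @^-1` S)) ->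
  \int[P]_(om in E) g (X om) <= P F.
Proof.
move=> mX mE mF FE g0 mg H.
pose X' om := (X om, om \in E).
have mEb : measurable_fun setT (fun om => om \in E).
  apply: (measurable_fun_bool true); rewrite setTI.
  by rewrite (_ : _ @^-1` _ = E)//; apply/seteqP; split => om /=; [exact: set_mem|exact: mem_set].
have mX' : measurable_fun setT X' by exact: measurable_fun_pair.
have X'E S : S `<=` setT `*` [set true] ->
    X' @^-1` S = E `&` X @^-1` [set x | S (x, true)].
  move=> SS; apply/seteqP; split => om; rewrite /X' /=.
    by move=> /[dup] /SS[_ /= omE]; rewrite omE; split => //; exact: set_mem.
  by move=> [omE]; rewrite mem_set.
have mS0 : measurable (setT `*` [set true] : set (T * bool)) by exact: measurableX.
have := @integral_density_le _ _ (image_measure P _ mX')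
  (image_measure (mrestr P mF) _ mX') (g \o fst) (setT `*` [set true]) mS0.
rewrite /image_measure ge0_integral_pushforward//; last 2 first.
  by apply: measurable_funTS; exact: measurableT_comp.
  by move=> z _ /=.
rewrite {1}/pushforward /= X'E//.
rewrite (_ : E `&` _ = E); last by apply/seteqP; split => [om []//|om ? /=]; split.
move=> /(_ _ _)/le_trans; apply => //; last first.
  rewrite /pushforward /= /mrestr; apply: le_measure; rewrite ?inE//.
  by apply: measurableI => //; rewrite -[X in measurable X]setTI; exact: mX'.
move=> S a mS SS a0 Sg; rewrite /pushforward /= /mrestr X'E//.
have mS1 : measurable [set x | S (x, true)].
  rewrite (_ : mkset _ = [set: T] `&` (fun x => (x, true)) @^-1` S) ?setTI//.
  by rewrite -(setTI (_ @^-1` _)); apply: measurable_fun_pair.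
rewrite [X in _ <= P X](_ : _ = F `&` X @^-1` [set x | S (x, true)]).
  by apply: H => // x /= /Sg.
apply/seteqP; split => om /=; first by tauto.
by move=> [Fo So]; split => //; split => //; exact: FE.
Qed.

Lemma integral_indic_mul {d} {T : measurableType d} (m : {measure set T -> \bar R})
    (S : set T) (f : T -> \bar R) :
  \int[m]_(x in S) f x = \int[m]_x ((\1_S x)%:E * f x).
Proof.
rewrite integral_mkcond epatch_indic.
by apply: eq_integral => x _; rewrite muleC.
Qed.

End generic.

Section kernel_precomp.
Context {d0 d1 d2} {T0 : measurableType d0} {T1 : measurableType d1}
  {T2 : measurableType d2} {R : realType}.
Variables (k : R.-pker T1 ~> T2) (f : T0 -> T1).
Hypothesis mf : measurable_fun setT f.

(** The measurability proof is an argument so that the kernel instances can be inferred from the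
    term alone. *)
Definition kernel_precomp (_ : measurable_fun setT f) :
  T0 -> {measure set T2 -> \bar R} := fun x => k (f x).

Let measurable_kernel_precomp U : measurable U ->
  measurable_fun setT (kernel_precomp mf ^~ U).
Proof.
by move=> mU; exact: measurableT_comp (measurable_kernel k _ mU) mf.
Qed.

HB.instance Definition _ := @isKernel.Build _ _ _ _ _ (kernel_precomp mf)
  measurable_kernel_precomp.

Let kernel_precomp_prob x : kernel_precomp mf x setT = 1%E.
Proof. exact: prob_kernel. Qed.

HB.instance Definition _ := @Kernel_isProbability.Build _ _ _ _ _
  (kernel_precomp mf) kernel_precomp_prob.

End kernel_precomp.

(** * Disintegration of a pair, from its values on a generating pi-system *)

Section disintegration.
Context {R : realType} {dO d1 d2} {Om : measurableType dO}
  {T1 : measurableType d1} {T2 : measurableType d2}.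
Variables (P : probability Om R) (X : Om -> T1) (Y : Om -> T2)
  (k : R.-pker T1 ~> T2) (G : set (set T1)).
Hypothesis mX : measurable_fun setT X.
Hypothesis mY : measurable_fun setT Y.
Hypothesis mG : measurable = <<s G >>.
Hypothesis GI : setI_closed G.
Hypothesis GT : G setT.
Local Open Scope ereal_scope.
Hypothesis XYk : forall A B, G A -> measurable B ->
  P (X @^-1` A `&` Y @^-1` B) = \int[P]_(om in X @^-1` A) k (X om) B.

Let mXY : measurable_fun setT (fun om => (X om, Y om)).
Proof. exact: measurable_fun_pair. Qed.

Let law := image_measure P _ mXY.

Let mXsnd : measurable_fun setT (fun p : Om * Om => X p.2).
Proof. exact: measurableT_comp mX measurable_snd. Qed.

Let mXfst : measurable_fun setT (fun p : (Om * Om) * T2 => (X p.1.2, p.2)).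
Proof.
apply: measurable_fun_pair => //.
apply: measurableT_comp mX _; exact: measurableT_comp measurable_snd measurable_fst.
Qed.

(** Draws y from [k (X om)] and returns (X om, y). Writing the candidate law as a composition of
    kernels provides both its countable additivity and its iterated integral; the first coordinate
    is only the dummy initial state [point]. *)
Let kk : R.-sfker (Om * Om) ~> (T1 * T2)%type :=
  mkcomp (kernel_precomp k _ mXsnd) (kdirac mXfst).

Let law' : {measure set (T1 * T2) -> \bar R} :=
  mkcomp (kprobability (@measurable_cst _ _ Om _ setT (P : pprobability Om R)))
    kk point.

Let integral_law' (f : T1 * T2 -> \bar R) : (forall z, 0 <= f z) ->
  measurable_fun setT f ->
  \int[law']_z f z = \int[P]_om \int[k (X om)]_y f (X om, y).
Proof.
move=> f0 mf; rewrite integral_kcomp//.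
transitivity (\int[P]_om \int[kk (point, om)]_z f z); first by [].
apply: eq_integral => om _; rewrite integral_kcomp//.
transitivity (\int[k (X om)]_y \int[kdirac mXfst ((point, om), y)]_z f z); first by [].
apply: eq_integral => y _.
by rewrite integral_dirac// diracT mul1e.
Qed.

Let law'X A B : measurable A -> measurable B ->
  law' (A `*` B) = \int[P]_(om in X @^-1` A) k (X om) B.
Proof.
move=> mA mB.
have mAB : measurable (A `*` B) by exact: measurableX.
rewrite -[in LHS](setIT (A `*` B)) -[in LHS]integral_indic// integral_law'//; last first.
  exact/measurable_EFinP/measurable_indic.
rewrite [RHS]integral_indic_mul; apply: eq_integral => om _.
rewrite -[in RHS](setIT B) -integral_indic// -ge0_integralZl//; last first.
  exact/measurable_EFinP/measurable_indic.
apply: eq_integral => y _.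
by rewrite -EFinM !indicE in_setX -mulnb natrM.
Qed.

(** For fixed B both sides are finite measures in A, namely the first marginals of the restrictions
    to the strip T1 x B, and they agree on the pi-system [G]. *)
Let law_setX A B : measurable A -> measurable B ->
  law (A `*` B) = law' (A `*` B).
Proof.
move=> mA mB.
have mSB : measurable (setT `*` B : set (T1 * T2)) by exact: measurableX.
have mf : measurable_fun [set: T1 * T2] fst by [].
have E C : image_measure (mrestr law mSB) _ mf C = law (C `*` B).
  rewrite /image_measure /pushforward /= /mrestr; congr (law _).
  by apply/seteqP; split => -[x y] /=; tauto.
have E' C : image_measure (mrestr law' mSB) _ mf C = law' (C `*` B).
  rewrite /image_measure /pushforward /= /mrestr; congr (law' _).
  by apply/seteqP; split => -[x y] /=; tauto.
rewrite -E -E'; apply: (finite_measure_eq G) => // [C GC|].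
  rewrite E E' law'X//; last by rewrite mG; exact: sub_sigma_algebra.
  rewrite -XYk//; congr (P _).
rewrite E; apply: (@le_lt_trans _ _ 1); last by rewrite ltry.
apply: (@probability_le1 _ _ _ P).
by rewrite -[X in measurable X]setTI; apply: mXY.
Qed.

Let law_eq A : measurable A -> law A = law' A.
Proof.
apply: (finite_measure_eq [set A `*` B | A in measurable & B in measurable]).
- by rewrite measurable_prod_measurableType.
- move=> _ _ [A1 mA1 [B1 mB1 <-]] [A2 mA2 [B2 mB2 <-]].
  by rewrite -setXI; exists (A1 `&` A2); [exact: measurableI|
    exists (B1 `&` B2) => //; exact: measurableI].
- by exists setT => //; exists setT => //; rewrite setXTT.
- by move=> _ [A' mA' [B' mB' <-]]; exact: law_setX.
- by rewrite [X in X < _]probability_setT ltry.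
Qed.

Lemma ge0_disintegration (f : T1 * T2 -> \bar R) : (forall z, 0 <= f z) ->
  measurable_fun setT f ->
  \int[P]_om f (X om, Y om) = \int[P]_om \int[k (X om)]_y f (X om, y).
Proof.
move=> f0 mf; rewrite -integral_law'//.
transitivity (\int[law]_z f z).
  by rewrite ge0_integral_pushforward.
by apply: eq_measure_integral => A mA _; exact: law_eq.
Qed.

End disintegration.

(** * Measurability of integrals with respect to a varying probability measure *)

Section pprobability_measurability.
Context {R : realType} {d} {T : measurableType d}.
Local Open Scope ereal_scope.

Lemma emeasurable_prod (I : Type) (s : seq I) (f : I -> T -> \bar R) :
  (forall i, measurable_fun setT (f i)) ->
  measurable_fun setT (fun x => \prod_(i <- s) f i x).
Proof.
move=> mf; elim: s => [|i s IH].
  by under eq_fun do rewrite big_nil; exact: measurable_cst.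
by under eq_fun do rewrite big_cons; exact: emeasurable_funM.
Qed.

Lemma measurable_pprobability_eval (A : set T) : measurable A ->
  measurable_fun setT (fun x : pprobability T R => (x : probability T R) A).
Proof.
move=> mA; exact: (measurable_kernel (kprobability (@measurable_id _ (pprobability T R) setT)) _ mA).
Qed.

Lemma measurable_pprobability_integral (A : set T) (f : T -> \bar R) :
  measurable A -> (forall y, 0 <= f y) -> measurable_fun setT f ->
  measurable_fun setT
    (fun x : pprobability T R => \int[(x : probability T R)]_(y in A) f y).
Proof.
move=> mA f0 mf.
under eq_fun do rewrite integral_indic_mul.
apply: (@measurable_fun_integral_kernel _ _ _ _ _
  (kprobability (@measurable_id _ (pprobability T R) setT))).
- by move=> U mU; exact: measurable_pprobability_eval.
- by move=> z; rewrite mule_ge0// lee_fin.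
- by apply: emeasurable_funM => //; exact/measurable_EFinP/measurable_indic.
Qed.

End pprobability_measurability.

(** * Probabilities of rectangles, and the effect of a single ghost constraint *)

Section rectangle_law.
Context {R : realType} {dZ} {Z : measurableType dZ}.
Variables (L : nat) (n : nat -> nat).
Local Notation Lt := (@Lt R dZ Z).
Local Open Scope ereal_scope.

Definition rect := forall h : nat, nat -> set (Lt h).

Definition measurable_rect (C : rect) := forall h j, measurable (C h j).

(* Sets are indexed by the role of a node (selected in [C], ghost in [G]) and not
   by its copy as in [Grect]; this makes the value independent of the selection
   pattern. *)
Fixpoint rectprob (C G : rect) (h : nat) : nat -> Lt h -> \bar R :=
  match h with
  | 0 => fun _ _ => 1
  | h'.+1 => fun j x =>
      \prod_(r < n (L - h')%N)
        (let c := (j * n (L - h')%N + r)%N in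
         (x : probability (Lt h') R) (G h' c) *
         \int[(x : probability (Lt h') R)]_(y in C h' c) rectprob C G h' c y)
  end.

Lemma rectprobS C G h j (x : Lt h.+1) : rectprob C G h.+1 j x =
  \prod_(r < n (L - h)%N)
    ((x : probability (Lt h) R) (G h (j * n (L - h)%N + r)%N) *
     \int[(x : probability (Lt h) R)]_(y in C h (j * n (L - h)%N + r)%N)
        rectprob C G h (j * n (L - h)%N + r)%N y).
Proof. by []. Qed.

Lemma rectprob_ge0 C G : measurable_rect G ->
  forall h j x, 0 <= rectprob C G h j x.
Proof.
move=> mG; elim=> [//|h IH] j x; rewrite rectprobS.
by apply: prode_ge0 => r _; rewrite mule_ge0// integral_ge0.
Qed.

Lemma measurable_rectprob C G : measurable_rect C -> measurable_rect G ->
  forall h j, measurable_fun setT (rectprob C G h j).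
Proof.
move=> mC mG; elim=> [j|h IH j]; first exact: measurable_cst.
apply: emeasurable_prod => r; apply: emeasurable_funM.
  exact: measurable_pprobability_eval.
by apply: measurable_pprobability_integral => // y; exact: rectprob_ge0.
Qed.

Definition supersample_rect (C G : rect) (u : nat -> nat -> bool) :
    forall h : nat, nat -> bool -> set (Lt h) :=
  fun h j b => if b == u h j then C h j else G h j.

Lemma GrectS A u h j (x : Lt h.+1) : @Grect R dZ Z L n A u h.+1 j x =
  \prod_(r < n (L - h)%N)
    \int[(x : probability (Lt h) R)]_(y1 in A h (j * n (L - h)%N + r)%N false)
      \int[(x : probability (Lt h) R)]_(y2 in A h (j * n (L - h)%N + r)%N true)
        @Grect R dZ Z L n A u h (j * n (L - h)%N + r)%N
          (if u h (j * n (L - h)%N + r)%N then y2 else y1).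
Proof. by []. Qed.

(** The copies are independent draws from the same measure and only the selected one has
    descendants, so the ghost integral factors out as a mass. The pattern only decides which of the
    two integrals is the inner one. *)
Lemma Grect_supersample C G u : measurable_rect C -> measurable_rect G ->
  forall h j x, @Grect R dZ Z L n (supersample_rect C G u) u h j x = rectprob C G h j x.
Proof.
move=> mC mG; elim=> [//|h IH] j x; rewrite GrectS rectprobS.
apply: eq_bigr => r _; set c := (_ * _ + _)%N.
have EA b : supersample_rect C G u h c b = if b == u h c then C h c else G h c by [].
rewrite !EA.
case: (u h c); rewrite ?eqxx /=.
  under eq_integral do under eq_integral do rewrite IH.
  by rewrite integral_cst// muleC.
under eq_integral.
  move=> y _; under eq_integral do rewrite IH.
  rewrite integral_cst//; over.
rewrite ge0_integralZr//; first by rewrite muleC.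
- by apply: measurable_funTS; exact: measurable_rectprob.
- by move=> y _; exact: rectprob_ge0.
Qed.

(** The type [Lt h] depends on the height, so a value at [h] can be tested against [S] only after
    transport along a proof of h = h0. Quantifying over such proofs makes the constraint vacuous at
    all other nodes. *)
Definition node_rect (h0 c0 : nat) (S : set (Lt h0)) : rect := fun h j =>
  [set y | forall e : h = h0, j = c0 -> S (eq_rect h Lt y h0 e)].

Lemma node_rect_eq h0 c0 S : node_rect h0 c0 S h0 c0 = S.
Proof.
apply/seteqP; split => y /=; first by move/(_ erefl erefl).
by move=> Sy e _; rewrite (eq_irrelevance e erefl).
Qed.

Lemma node_rect_neq h0 c0 S h j : ~ (h = h0 /\ j = c0) ->
  node_rect h0 c0 S h j = setT.
Proof.
by move=> ne; apply/seteqP; split => y //= _ e1 e2; exfalso; apply: ne.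
Qed.

Lemma measurable_node_rect h0 c0 S : measurable S ->
  measurable_rect (node_rect h0 c0 S).
Proof.
move=> mS h j; have [[-> ->]|ne] := pselect (h = h0 /\ j = c0).
  by rewrite node_rect_eq.
by rewrite node_rect_neq.
Qed.

Definition setT_rect : rect := fun _ _ => setT.

Lemma measurable_setT_rect : measurable_rect setT_rect.
Proof. by move=> h j; exact: measurableT. Qed.

(* The ancestor at height [h] of the node [c0] of height [h0] (and [c0] itself
   for [h <= h0]). *)
Fixpoint anc (h0 c0 h : nat) : nat :=
  match h with
  | 0 => c0
  | h'.+1 => if (h' < h0)%N then c0 else (anc h0 c0 h' %/ n (L - h'))%N
  end.

Lemma anc0 h0 c0 : anc h0 c0 h0 = c0.
Proof. by case: h0 => [//|h0] /=; rewrite ltnSn. Qed.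

Lemma ancS h0 c0 h : (h0 <= h)%N ->
  anc h0 c0 h.+1 = (anc h0 c0 h %/ n (L - h))%N.
Proof. by move=> hh /=; rewrite ltnNge hh. Qed.

Section one_ghost.
Variables (C : rect) (h0 c0 : nat) (G0 : set (Lt h0)).
Hypothesis mC : measurable_rect C.
Hypothesis mG0 : measurable G0.
Let G := node_rect h0 c0 G0.
Let a_ := anc h0 c0.

Let mG : measurable_rect G. Proof. exact: measurable_node_rect. Qed.

(** [rectprob] at a node constrains its strict descendants only, and [c0] is not one of them: a
    child of [j] on the path to the root would force [j] onto the path. *)
Lemma rectprob_off_path h j x : (h <= h0)%N \/ j <> a_ h ->
  rectprob C G h j x = rectprob C setT_rect h j x.
Proof.
elim: h => [//|h IH] in j x * => hj; rewrite !rectprobS.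
apply: eq_bigr => r _; set c := (_ + _)%N.
have cj : (c %/ n (L - h) = j)%N.
  have n0 : (0 < n (L - h))%N by case: (n _) r @c => [[]|].
  by rewrite /c divnMDl// divn_small// addn0.
have hc : (h <= h0)%N \/ c <> a_ h.
  case: hj => [/ltnW|ja]; first by left.
  have [|hh] := leqP h h0; first by left.
  by right => ca; apply: ja; rewrite /a_ ancS 1?ltnW// -/a_ -ca.
rewrite /G node_rect_neq -/G.
  by congr (_ * _); apply: eq_integral => y _; exact: IH.
move=> [hh0 cc0]; case: hj; first by rewrite hh0 ltnn.
by apply; rewrite /a_ ancS hh0// anc0 -cc0 -cj hh0.
Qed.

Lemma rectprob_parent x : (0 < n (L - h0))%N ->
  rectprob C G h0.+1 (a_ h0.+1) x =
  (x : probability (Lt h0) R) G0 * rectprob C setT_rect h0.+1 (a_ h0.+1) x.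
Proof.
move=> n0; rewrite !rectprobS.
(* In the mixed radix code the quotient of [c0] is its parent and the remainder is its rank among
   the siblings. *)
have r0P : (c0 %% n (L - h0) < n (L - h0))%N by rewrite ltn_mod.
pose r0 := Ordinal r0P.
have E : (a_ h0.+1 * n (L - h0) + c0 %% n (L - h0) = c0)%N.
  by rewrite /a_ ancS// anc0 -divn_eq.
rewrite (bigD1 r0)//= [in RHS](bigD1 r0)//= E /G node_rect_eq -/G.
rewrite probability_setT mul1e -muleA; congr (_ * (_ * _)).
  by apply: eq_integral => y _; apply: rectprob_off_path; left.
apply: eq_bigr => r rr0; rewrite /G node_rect_neq -/G.
  rewrite probability_setT.
  by congr (_ * _); apply: eq_integral => y _; apply: rectprob_off_path; left.
move=> [_ cc]; move/eqP: rr0; apply; apply: val_inj => /=.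
by rewrite -cc modnMDl modn_small.
Qed.

(* Only one child of each ancestor of the ghost sees the change, so the factor [a]
   is picked up exactly once on the way up to the root. *)
Lemma rectprob_scale (a : R) h x : (forall h, (h < L)%N -> (0 < n (L - h))%N) ->
  (0 <= a)%R -> (h0 < h <= L)%N ->
  (forall y, C h0.+1 (a_ h0.+1) y -> a%:E <= (y : probability (Lt h0) R) G0) ->
  (h0.+1 < h)%N \/ C h (a_ h) x ->
  a%:E * rectprob C setT_rect h (a_ h) x <= rectprob C G h (a_ h) x.
Proof.
move=> n0 a0 + Ca; elim: h => [//|h IH] in x *; rewrite ltnS => /andP[].
rewrite leq_eqVlt => /predU1P[h0h|h0h] hL hx.
  (* Here [x] is the parent of the ghost itself, and the lower bound is known only on [C]. Higher
     up, the integration over [C h] supplies this membership. *)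
  case: hx; first by rewrite h0h ltnn.
  move: x hL; rewrite -h0h => x hL Cx.
  rewrite rectprob_parent; last exact: n0.
  by apply: lee_wpmul2r; [apply: rectprob_ge0; exact: measurable_setT_rect|exact: Ca].
rewrite !rectprobS.
have r0P : (a_ h %% n (L - h) < n (L - h))%N by rewrite ltn_mod n0.
pose r0 := Ordinal r0P.
have E : (a_ h.+1 * n (L - h) + a_ h %% n (L - h) = a_ h)%N.
  by rewrite /a_ ancS 1?ltnW// -divn_eq.
have Gh c : G h c = setT by rewrite /G node_rect_neq// => -[hh0 _]; rewrite hh0 ltnn in h0h.
rewrite (bigD1 r0)//= [leRHS](bigD1 r0)//= E Gh probability_setT !mul1e muleA.
rewrite [X in _ * X <= _](_ : _ = \prod_(i < n (L - h) | i != r0)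
  ((x : probability (Lt h) R) (G h (a_ h.+1 * n (L - h) + i)%N) *
   \int[(x : probability (Lt h) R)]_(y in C h (a_ h.+1 * n (L - h) + i)%N)
     rectprob C G h (a_ h.+1 * n (L - h) + i)%N y)).
  apply: lee_wpmul2r.
    by apply: prode_ge0 => r _; rewrite mule_ge0// integral_ge0// => y _; exact: rectprob_ge0.
  have mT := @measurable_setT_rect.
  rewrite -ge0_integralZl//.
  - apply: ge0_le_integral => //.
    + by move=> y _; rewrite mule_ge0//; exact: rectprob_ge0.
    + by apply: measurable_funeM; apply: measurable_funTS; exact: measurable_rectprob.
    + by apply: measurable_funTS; exact: measurable_rectprob.
    + by move=> y Cy; apply: IH; [rewrite h0h ltnW|right].
  - by apply: measurable_funTS; exact: measurable_rectprob.
  - by move=> y _; exact: rectprob_ge0.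
apply: eq_bigr => r rr0; rewrite Gh probability_setT; congr (_ * _); apply: eq_integral => y _.
apply/esym/rectprob_off_path; right => ca; move/eqP: rr0; apply; apply: val_inj => /=.
by rewrite -ca modnMDl modn_small.
Qed.

End one_ghost.

End rectangle_law.

(** * Conditional laws in the supersample *)

Section supersample.
Context {R : realType} {dZ} {Z : measurableType dZ} {dW} {Wsp : measurableType dW}.
Variables (L : nat) (n : nat -> nat).
Hypothesis n_ge1 : forall k, (1 <= k <= L)%N -> (1 <= n k)%N.
Local Notation Lt := (@Lt R dZ Z).
Local Notation rect := (@rect R dZ Z).
Local Notation setT_rect := (@setT_rect R dZ Z).
Variables (D : Lt L) (K : R.-pker (TreeM R Z L n) ~> Wsp).
Context {dO} {Om : measurableType dO}.
Variables (P : probability Om R) (MT : forall h : nat, nat -> bool -> Om -> Lt h)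
  (U : nat -> nat -> Om -> bool) (W : Om -> Wsp).
Hypothesis MT_meas : forall h j b, relevant L n h j -> measurable_fun setT (MT h j b).
Hypothesis U_meas : forall h j, relevant L n h j -> measurable_fun setT (U h j).
Hypothesis W_meas : measurable_fun setT W.
Hypothesis law_tree : forall (A : forall h : nat, nat -> bool -> set (Lt h))
    (u : nat -> nat -> bool),
  (forall h j b, relevant L n h j -> measurable (A h j b)) ->
  P (rectE L n MT U A u) =
    (((2^-1 : R) ^+ nnodes L n)%:E * @Grect R dZ Z L n A u L 0 D)%E.
Hypothesis law_W : forall (A : forall h : nat, nat -> bool -> set (Lt h))
    (u : nat -> nat -> bool) (B : set Wsp),
  (forall h j b, relevant L n h j -> measurable (A h j b)) -> measurable B ->
  P (rectE L n MT U A u `&` W @^-1` B) =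
    (\int[P]_(om in rectE L n MT U A u) K (selT MT U om) B)%E.
Local Open Scope ereal_scope.

Definition ghost h j om : Lt h := MT h j (~~ U h j om) om.

Let sel h j om : Lt h := selT MT U om h j.

Lemma branching_gt0 h : (h < L)%N -> (0 < n (L - h))%N.
Proof. by move=> hL; apply: n_ge1; rewrite subn_gt0 hL leq_subr. Qed.

Lemma measurable_sel h j : relevant L n h j -> measurable_fun setT (sel h j).
Proof.
move=> hj.
rewrite (_ : sel h j = fun om => if U h j om then MT h j true om else MT h j false om).
  by apply: measurable_fun_ifT; [exact: U_meas|exact: MT_meas|exact: MT_meas].
by apply/funext => om; rewrite /sel /selT; case: (U h j om).
Qed.

Lemma measurable_ghost h j : relevant L n h j -> measurable_fun setT (ghost h j).
Proof.
move=> hj.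
rewrite (_ : ghost h j = fun om => if U h j om then MT h j false om else MT h j true om).
  by apply: measurable_fun_ifT; [exact: U_meas|exact: MT_meas|exact: MT_meas].
by apply/funext => om; rewrite /ghost; case: (U h j om).
Qed.

Lemma measurable_selT : measurable_fun setT (selT MT U : Om -> TreeM R Z L n).
Proof.
apply: (@measurability _ _ Om (TreeM R Z L n) setT _ (@treeG R dZ Z L n)) => // _ [_ [h [j [hj [B [mB ->]]]]] <-].
rewrite setTI.
have := measurable_sel _ _ hj measurableT B mB; rewrite setTI; exact.
Qed.

Definition node : finType := {h : 'I_L & 'I_(Nl n (L - h))}.
Definition pattern : finType := {ffun node -> bool}.

(** The default [false] is harmless, because [rectE] reads relevant nodes only. *)
Definition pattern_fun (f : pattern) (h j : nat) : bool :=
  if (insub h : option 'I_L) is Some h' then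
    if (insub j : option 'I_(Nl n (L - h'))) is Some j' then
      f (Tagged (fun h : 'I_L => 'I_(Nl n (L - h))) j')
    else false
  else false.

Lemma pattern_funE (f : pattern) (x : node) :
  pattern_fun f (tag x) (tagged x) = f x.
Proof. by case: x => h j /=; rewrite /pattern_fun !valK. Qed.

Lemma relevant_node (x : node) : relevant L n (tag x) (tagged x).
Proof. by case: x => h j; split => /=. Qed.

Lemma relevantP h j : relevant L n h j ->
  exists x : node, h = tag x /\ j = tagged x :> nat.
Proof.
move=> [hL jN].
by exists (Tagged (fun h : 'I_L => 'I_(Nl n (L - h))) (Ordinal jN : 'I_(Nl n (L - Ordinal hL)))).
Qed.

Definition pattern_of (om : Om) : pattern := [ffun x : node => U (tag x) (tagged x) om].

Definition tree_event (C G : rect) : set Om :=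
  [set om | forall h j, relevant L n h j -> C h j (sel h j om) /\ G h j (ghost h j om)].

(** Once the pattern is fixed, copy [U] is the selected node and copy [~~ U] the ghost, so
    constraints by role and constraints by copy coincide. *)
Lemma rectE_supersample (C G : rect) f :
  rectE L n MT U (supersample_rect C G (pattern_fun f)) (pattern_fun f) =
  tree_event C G `&` pattern_of @^-1` [set f].
Proof.
apply/seteqP; split => om /=.
  move=> H; split.
    move=> h j hj; have [HA HU] := H _ _ hj.
    have := HA (U h j om); have := HA (~~ U h j om).
    rewrite /supersample_rect -HU eqxx.
    by rewrite (_ : (~~ _ == _) = false)//; case: (U h j om).
  apply/ffunP => x; rewrite ffunE -pattern_funE.
  by have [] := H _ _ (relevant_node x).
move=> [H <-] h j /[dup] hj /relevantP[x [hx jx]].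
have HU : U h j om = pattern_fun (pattern_of om) h j.
  by rewrite hx jx pattern_funE ffunE.
split => // b; have [Hs Hg] := H _ _ hj.
rewrite /supersample_rect -HU; case: eqP => [->//|/eqP bU].
by rewrite (_ : b = ~~ U h j om)//; case: b (U h j om) bU => -[].
Qed.

Lemma measurable_tree_event C G : measurable_rect C -> measurable_rect G ->
  measurable (tree_event C G).
Proof.
move=> mC mG.
rewrite (_ : tree_event C G = \bigcap_(x in [set: node])
   (sel (tag x) (tagged x) @^-1` C (tag x) (tagged x) `&`
    ghost (tag x) (tagged x) @^-1` G (tag x) (tagged x))).
  apply: fin_bigcap_measurable => // x _; apply: measurableI.
    by rewrite -[X in measurable X]setTI; apply: measurable_sel => //; exact: relevant_node.
  by rewrite -[X in measurable X]setTI; apply: measurable_ghost => //; exact: relevant_node.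
apply/seteqP; split => om.
  by move=> H x _; exact: H (relevant_node x).
by move=> H h j /relevantP[x [-> ->]]; exact: H.
Qed.

Lemma measurable_pattern f : measurable (pattern_of @^-1` [set f]).
Proof.
rewrite (_ : _ @^-1` _ = \bigcap_(x in [set: node])
   (U (tag x) (tagged x) @^-1` [set f x])).
  apply: fin_bigcap_measurable => // x _.
  by rewrite -[X in measurable X]setTI; apply: U_meas => //; exact: relevant_node.
apply/seteqP; split => om /=; first by move=> <- x _ /=; rewrite ffunE.
by move=> H; apply/ffunP => x; rewrite ffunE; exact: H.
Qed.

Lemma integral_pattern E (g : Om -> \bar R) : measurable E ->
  measurable_fun setT g -> (forall om, 0 <= g om) ->
  \int[P]_(om in E) g om =
  \sum_(f : pattern) \int[P]_(om in E `&` pattern_of @^-1` [set f]) g om.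
Proof.
move=> mE mg g0.
rewrite -ge0_integral_bigsetU//.
- congr (integral _ _ _); rewrite -bigcup_seq.
  apply/seteqP; split => om; last by move=> [f _ []].
  by move=> Eom; exists (pattern_of om) => //=; rewrite mem_index_enum.
- by move=> f; apply: measurableI => //; exact: measurable_pattern.
- exact: index_enum_uniq.
- by apply/trivIsetP => f1 f2 _ _ f12; apply/seteqP; split => // om [[_ /= e1] [_ /= e2]];
    by move/eqP: f12; apply; rewrite -e1 -e2.
- exact: measurable_funTS.
Qed.

Lemma probability_pattern E : measurable E ->
  P E = \sum_(f : pattern) P (E `&` pattern_of @^-1` [set f]).
Proof.
move=> mE; rewrite -[LHS]mul1e -integral_cst// integral_pattern//.
by apply: eq_bigr => f _; rewrite integral_cst ?mul1e//;
  apply: measurableI => //; exact: measurable_pattern.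
Qed.

Lemma measurable_supersample_rect (C G : rect) u : measurable_rect C -> measurable_rect G ->
  forall h j b, relevant L n h j -> measurable (supersample_rect C G u h j b).
Proof. by move=> mC mG h j b _; rewrite /supersample_rect; case: ifP. Qed.

Let w : R := ((2^-1) ^+ nnodes L n)%R.

(** The value does not depend on [f]: the pattern is uniform and independent of the tree indexed by
    roles. *)
Lemma probability_tree_event_pattern (C G : rect) f : measurable_rect C -> measurable_rect G ->
  P (tree_event C G `&` pattern_of @^-1` [set f]) = w%:E * rectprob L n C G L 0%N D.
Proof.
move=> mC mG; rewrite -rectE_supersample law_tree ?Grect_supersample//.
exact: measurable_supersample_rect.
Qed.

Lemma rectprob_setT h j x : rectprob L n setT_rect setT_rect h j x = 1.
Proof.
elim: h => [//|h IH] in j x *; rewrite rectprobS big1// => r _.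
rewrite probability_setT mul1e; under eq_integral do rewrite IH.
rewrite (_ : setT_rect _ _ = setT)// integral_cst// mul1e; exact: probability_setT.
Qed.

Lemma tree_event_setT : tree_event setT_rect setT_rect = setT.
Proof. by apply/seteqP; split. Qed.

(** Patterns need not be counted: the trivial rectangle has total mass 1 and splits into equal
    weights. *)
Lemma sum_weights : (\sum_(f : pattern) w = 1)%R.
Proof.
have := probability_pattern setT measurableT.
rewrite probability_setT -tree_event_setT.
have mT : measurable_rect setT_rect by exact: measurable_setT_rect.
under eq_bigr do rewrite (probability_tree_event_pattern _ _ _ mT mT) rectprob_setT mule1.
by rewrite sumEFin => -[].
Qed.

Lemma probability_tree_event C G : measurable_rect C -> measurable_rect G ->
  P (tree_event C G) = rectprob L n C G L 0%N D.
Proof.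
move=> mC mG; rewrite probability_pattern; last exact: measurable_tree_event.
under eq_bigr do rewrite probability_tree_event_pattern//.
rewrite -ge0_sume_distrl; last by move=> f _; rewrite lee_fin exprn_ge0// invr_ge0.
by rewrite sumEFin sum_weights mul1e.
Qed.

(** Flipping the bit at [x] is an involution that exchanges the two halves. *)
Lemma sum_weights_half (x : node) (b : bool) :
  (\sum_(f : pattern | f x == b) w = 2^-1)%R.
Proof.
pose flip (f : pattern) : pattern := [ffun y => if y == x then ~~ f y else f y].
have flipK : involutive flip.
  by move=> f; apply/ffunP => y; rewrite !ffunE; case: (y == x) => //; rewrite negbK.
have E c : (\sum_(f : pattern | f x == c) w = \sum_(f : pattern | f x == ~~ c) w)%R.
  rewrite (reindex_inj (inv_inj flipK)); apply: eq_bigl => f.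
  by rewrite ffunE eqxx; case: (f x) c => -[].
have := sum_weights; rewrite (bigID (fun f : pattern => f x == b))/=.
rewrite [X in (_ + X)%R](_ : _ = \sum_(f : pattern | f x == b) w)%R.
  by set t := (\sum_(_ | _) w)%R => tt1; lra.
rewrite [RHS]E; apply: eq_bigl => f.
by case: (f x) b => -[].
Qed.

Lemma probability_tree_event_U C G h j b : measurable_rect C -> measurable_rect G ->
  relevant L n h j ->
  P (tree_event C G `&` U h j @^-1` [set b]) = (2^-1)%:E * rectprob L n C G L 0%N D.
Proof.
move=> mC mG /[dup] hj /relevantP[x [hx jx]].
have mU : measurable (U h j @^-1` [set b]).
  by rewrite -[X in measurable X]setTI; exact: U_meas.
have mE := measurable_tree_event _ _ mC mG.
rewrite probability_pattern; last exact: measurableI.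
rewrite -(sum_weights_half x b) -sumEFin ge0_sume_distrl; last first.
  by move=> f _; rewrite lee_fin exprn_ge0// invr_ge0.
rewrite [RHS]big_mkcond; apply: eq_bigr => f _.
case: eqP => fx.
  rewrite -(probability_tree_event_pattern _ _ f)//; congr (P _).
  apply/seteqP; split => om /=; first by tauto.
  by move=> [? fom]; split => //; split => //; rewrite hx jx -fx -fom ffunE.
rewrite (_ : _ `&` _ = set0) ?measure0//; apply/seteqP; split => // om [[_ /= Ub] /= fom].
by apply: fx; rewrite -fom ffunE -jx -hx.
Qed.

Lemma law_W_tree_event C G B : measurable_rect C -> measurable_rect G -> measurable B ->
  P (tree_event C G `&` W @^-1` B) = \int[P]_(om in tree_event C G) K (selT MT U om) B.
Proof.
move=> mC mG mB; have mE := measurable_tree_event _ _ mC mG.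
have mWB : measurable (W @^-1` B) by rewrite -[X in measurable X]setTI; exact: W_meas.
rewrite probability_pattern; last exact: measurableI.
rewrite integral_pattern//; last first.
  exact: measurableT_comp (measurable_kernel K _ mB) measurable_selT.
apply: eq_bigr => f _.
rewrite setIAC -rectE_supersample law_W//.
exact: measurable_supersample_rect.
Qed.

Lemma NlS l : Nl n l.+1 = (Nl n l * n l.+1)%N.
Proof. by rewrite /Nl big_nat_recr. Qed.

Lemma subnS_lt h : (h < L)%N -> (L - h = (L - h.+1).+1)%N.
Proof. by move=> hL; rewrite subnSK. Qed.

Lemma ltn_parent h c : (h < L)%N ->
  (c %/ n (L - h) < Nl n (L - h.+1))%N = (c < Nl n (L - h))%N.
Proof.
move=> hL; rewrite ltn_divLR ?branching_gt0//.
by rewrite (subnS_lt h hL) NlS.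
Qed.

(* Extends the tree by its root, which is the constant [D]. *)
Definition node_value (h j : nat) (t : Tree R Z) : Lt h :=
  if pselect (L = h) is left e then eq_rect L Lt D h e else t h j.

Lemma node_value_lt h j t : (h < L)%N -> node_value h j t = t h j.
Proof.
by move=> hL; rewrite /node_value; case: pselect => // e; rewrite -e ltnn in hL.
Qed.

Lemma node_value_root j t : node_value L j t = D.
Proof.
by rewrite /node_value; case: pselect => // e; rewrite (eq_irrelevance e erefl).
Qed.

Definition parent (h0 c0 : nat) (t : Tree R Z) : Lt h0.+1 :=
  node_value h0.+1 (c0 %/ n (L - h0))%N t.

Lemma measurable_coord h j : relevant L n h j ->
  measurable_fun setT (fun t : TreeM R Z L n => (t : Tree R Z) h j).
Proof.
move=> hj _ B mB; rewrite setTI; apply: sub_sigma_algebra.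
by exists h, j; split => //; exists B.
Qed.

Lemma relevant_parent h0 c0 : relevant L n h0 c0 -> L <> h0.+1 ->
  relevant L n h0.+1 (c0 %/ n (L - h0))%N.
Proof.
move=> [hL cN] ne; split; last by rewrite ltn_parent.
by rewrite ltn_neqAle hL andbT; apply/eqP => e; apply: ne.
Qed.

Lemma measurable_parent h0 c0 : relevant L n h0 c0 ->
  measurable_fun setT (fun t : TreeM R Z L n => parent h0 c0 t).
Proof.
move=> hj; rewrite /parent /node_value; case: pselect => [e|ne]; first exact: measurable_cst.
exact: (measurable_coord _ _ (relevant_parent _ _ hj ne)).
Qed.

Lemma rectprob_cast C G h h' (e : h = h') j (x : Lt h) :
  rectprob L n C G h' j (eq_rect h Lt x h' e) = rectprob L n C G h j x.
Proof. by case: _ / e. Qed.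

Lemma anc_lt h0 c0 : relevant L n h0 c0 -> forall h, (h0 <= h <= L)%N ->
  (anc L n h0 c0 h < Nl n (L - h))%N.
Proof.
move=> [h0L cN]; elim=> [|h IH] /andP[].
  by rewrite leqn0 => /eqP h00 _; move: cN; rewrite h00.
rewrite leq_eqVlt => /predU1P[<-|h0h] hL; first by rewrite anc0.
by rewrite ancS// ltn_parent// IH// (ltnW hL) -ltnS h0h.
Qed.

Lemma anc_root h0 c0 : relevant L n h0 c0 -> anc L n h0 c0 L = 0%N.
Proof.
move=> /[dup] hj [h0L _].
have := anc_lt _ _ hj L; rewrite leqnn (ltnW h0L) subnn => /(_ isT).
by rewrite /Nl big_geq// ltnS leqn0 => /eqP.
Qed.

Lemma measurable_eval_parent h0 c0 G0 : relevant L n h0 c0 -> measurable G0 ->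
  measurable_fun setT (fun t : TreeM R Z L n =>
    (parent h0 c0 t : probability (Lt h0) R) G0).
Proof.
move=> hj mG0.
exact: measurableT_comp (measurable_pprobability_eval _ mG0) (measurable_parent _ _ hj).
Qed.

Lemma measurable_rectI C C' : measurable_rect C -> measurable_rect C' ->
  measurable_rect ((fun h j => C h j `&` C' h j) : rect).
Proof. by move=> mC mC' h j; exact: measurableI. Qed.

Lemma tree_event_node C G h0 c0 (S : set (Lt h0)) : relevant L n h0 c0 ->
  tree_event (fun h j => C h j `&` node_rect h0 c0 S h j) G =
  tree_event C G `&` sel h0 c0 @^-1` S.
Proof.
move=> hj; apply/seteqP; split => om /=.
  move=> H; split; first by move=> h j /H[[]].
  by have [[_]] := H _ _ hj; rewrite node_rect_eq.
move=> [H So] h j /[dup] /H[? ?] _; split => //; split => //.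
have [[hh jj]|ne] := pselect (h = h0 /\ j = c0); last by rewrite node_rect_neq.
by subst h j; rewrite node_rect_eq.
Qed.

(** * The law of a ghost given the selected tree and W *)

Section ghost.
Variables (h0 c0 : nat) (G0 : set (Lt h0)).
Hypothesis hj : relevant L n h0 c0.
Hypothesis mG0 : measurable G0.

Let mN : measurable_rect (node_rect h0 c0 G0).
Proof. exact: measurable_node_rect. Qed.

(** If the parent is the root, it is the constant [D], and [rectprob_parent] gives the factor
    exactly. Otherwise the mass of [G0] is random: [integral_density_le_comp] reduces it to
    constants, which [rectprob_scale] carries up to the root. *)
Lemma tree_event_ghost_le C : measurable_rect C ->
  \int[P]_(om in tree_event C setT_rect)
    (parent h0 c0 (selT MT U om) : probability (Lt h0) R) G0 <=
  P (tree_event C (node_rect h0 c0 G0)).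
Proof.
move=> mC; have mT : measurable_rect setT_rect by exact: measurable_setT_rect.
have [h0L c0N] := hj.
rewrite /parent /node_value; case: pselect => [e|ne].
  rewrite integral_cst; last exact: measurable_tree_event.
  rewrite (probability_tree_event _ _ mC mN) [X in _ * X](probability_tree_event _ _ mC mT).
  rewrite -!(rectprob_cast _ _ _ _ e).
  have a0 : anc L n h0 c0 h0.+1 = 0%N by rewrite -e; exact: anc_root.
  have := rectprob_parent L n C h0 c0 G0 (eq_rect L Lt D h0.+1 e) (branching_gt0 _ h0L).
  by rewrite a0 => ->.
have hp := relevant_parent _ _ hj ne.
apply: (integral_density_le_comp P (sel h0.+1 (c0 %/ n (L - h0)))
  (tree_event C setT_rect) (tree_event C (node_rect h0 c0 G0))
  (fun x => (x : probability (Lt h0) R) G0)).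
- exact: measurable_sel.
- exact: measurable_tree_event.
- exact: measurable_tree_event.
- by move=> om H h j /H[].
- by [].
- exact: measurable_pprobability_eval.
move=> S a mS a0 Sa.
(* The extra constraint [S] on the parent keeps the event a rectangle, so its probability is again a
   value of [rectprob]. *)
have mCS := measurable_rectI _ _ mC (measurable_node_rect h0.+1 (c0 %/ n (L - h0)) S mS).
rewrite -!tree_event_node//.
rewrite [leRHS](probability_tree_event _ _ mCS mN).
rewrite [X in _ * X](probability_tree_event _ _ mCS mT).
rewrite -(anc_root _ _ hj); apply: rectprob_scale => //.
- exact: branching_gt0.
- by rewrite h0L leqnn.
- by move=> y []; rewrite ancS// anc0 node_rect_eq => _; exact: Sa.
- by left; case: hp.
Qed.

Lemma tree_event_ghost C (S : set (Lt h0)) :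
  tree_event C (node_rect h0 c0 S) = tree_event C setT_rect `&` ghost h0 c0 @^-1` S.
Proof.
apply/seteqP; split => om /=.
  move=> H; split; first by move=> h j /H[].
  by have [_] := H _ _ hj; rewrite node_rect_eq.
move=> [H So] h j /[dup] /H[? _] _; split => //.
have [[hh jj]|ne] := pselect (h = h0 /\ j = c0); last by rewrite node_rect_neq.
by subst h j; rewrite node_rect_eq.
Qed.

End ghost.

(* The bound [tree_event_ghost_le], applied to [G0] and to its complement, sums
   to an equality. *)
Lemma probability_ghost h0 c0 G0 C : relevant L n h0 c0 -> measurable G0 ->
  measurable_rect C ->
  P (tree_event C setT_rect `&` ghost h0 c0 @^-1` G0) =
  \int[P]_(om in tree_event C setT_rect)
    (parent h0 c0 (selT MT U om) : probability (Lt h0) R) G0.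
Proof.
move=> hj mG0 mC; have mT : measurable_rect setT_rect by exact: measurable_setT_rect.
have mE := measurable_tree_event _ _ mC mT.
pose I S := \int[P]_(om in tree_event C setT_rect)
  (parent h0 c0 (selT MT U om) : probability (Lt h0) R) S.
pose p S := P (tree_event C setT_rect `&` ghost h0 c0 @^-1` S).
have mg S : measurable S -> measurable (ghost h0 c0 @^-1` S).
  by move=> mS; rewrite -[X in measurable X]setTI; exact: measurable_ghost.
have le S : measurable S -> I S <= p S.
  by move=> mS; rewrite /p -tree_event_ghost//; exact: tree_event_ghost_le.
have pD : p G0 + p (~` G0) = P (tree_event C setT_rect).
  rewrite /p -measureU//; try by apply: measurableI => //; apply: mg => //; exact: measurableC.
    by rewrite -setIUr -preimage_setU setUv preimage_setT setIT.
  by apply/seteqP; split => // om [[_ /=] ?] [].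
have mI S : measurable S -> measurable_fun setT (fun om =>
    (parent h0 c0 (selT MT U om) : probability (Lt h0) R) S).
  by move=> mS; exact: measurableT_comp (measurable_eval_parent _ _ _ hj mS) measurable_selT.
have ID : I G0 + I (~` G0) = P (tree_event C setT_rect).
  rewrite /I -ge0_integralD//; try by apply: measurable_funTS; apply: mI => //; exact: measurableC.
  rewrite -[RHS]mul1e -integral_cst//; apply: eq_integral => om _.
  have mGC := measurableC mG0.
  by rewrite -measureU// ?setICr// setUv; exact: probability_setT.
have mGC := measurableC mG0.
have Ifin : I (~` G0) \is a fin_num.
  rewrite ge0_fin_numE ?integral_ge0//; apply: le_lt_trans (le _ mGC) _.
  rewrite ltey_eq fin_num_measure//.
  by apply: measurableI => //; exact: mg.
apply/eqP; rewrite eq_le le// andbT leNgt; apply/negP => lt.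
have : I G0 + I (~` G0) < p G0 + p (~` G0) by apply: lte_leD => //; exact: le.
by rewrite pD ID ltxx.
Qed.

Definition tree_rect (C : rect) : set (TreeM R Z L n) :=
  [set t | forall h j, relevant L n h j -> C h j ((t : Tree R Z) h j)].

Definition tree_rects : set (set (TreeM R Z L n)) :=
  [set tree_rect C | C in @measurable_rect R dZ Z].

Lemma preimage_tree_rect C : selT MT U @^-1` tree_rect C = tree_event C setT_rect.
Proof.
apply/seteqP; split => om /=; last by move=> H h j /H[].
by move=> H h j hj; split => //; exact: H.
Qed.

Lemma tree_rects_setI : setI_closed tree_rects.
Proof.
move=> _ _ [C mC <-] [C' mC' <-]; exists (fun h j => C h j `&` C' h j).
  exact: measurable_rectI.
apply/seteqP; split => t /=.
  by move=> H; split => h j /H[].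
by move=> [H H'] h j hj; split; [exact: H|exact: H'].
Qed.

Lemma tree_rects_setT : tree_rects setT.
Proof.
by exists setT_rect; [exact: measurable_setT_rect|apply/seteqP; split].
Qed.

Lemma measurable_tree_rects : @measurable _ (TreeM R Z L n) = <<s tree_rects >>.
Proof.
apply/seteqP; split; apply: smallest_sub.
- exact: smallest_sigma_algebra.
- move=> _ [h [j [hj [B [mB ->]]]]]; apply: sub_sigma_algebra.
  exists (node_rect h j B); first exact: measurable_node_rect.
  apply/seteqP; split => t /=; first by move/(_ _ _ hj); rewrite node_rect_eq.
  move=> Bt h' j' _.
  have [[hh jj]|ne] := pselect (h' = h /\ j' = j); last by rewrite node_rect_neq.
  by subst h' j'; rewrite node_rect_eq.
- exact: (@sigma_algebra_measurable _ (TreeM R Z L n)).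
- move=> _ [C mC <-].
  rewrite (_ : tree_rect C = \bigcap_(x in [set: node])
    (fun t : TreeM R Z L n => (t : Tree R Z) (tag x) (tagged x)) @^-1` C (tag x) (tagged x)).
    apply: fin_bigcap_measurable => // x _.
    rewrite -[X in measurable X]setTI.
    by apply: (measurable_coord _ _ (relevant_node x)).
  apply/seteqP; split => t; first by move=> H x _; exact: H (relevant_node x).
  by move=> H h j /relevantP[x [-> ->]]; exact: H.
Qed.

Lemma tree_loss_disintegration (f : TreeM R Z L n * Wsp -> \bar R) :
  (forall z, 0 <= f z) -> measurable_fun setT f ->
  \int[P]_om f (selT MT U om, W om) =
  \int[P]_om \int[K (selT MT U om)]_w f (selT MT U om, w).
Proof.
apply: (ge0_disintegration P (selT MT U : Om -> TreeM R Z L n) W K tree_rects).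
- exact: measurable_selT.
- exact: W_meas.
- exact: measurable_tree_rects.
- exact: tree_rects_setI.
- exact: tree_rects_setT.
- move=> _ B [C mC <-] mB; rewrite preimage_tree_rect law_W_tree_event//.
  exact: measurable_setT_rect.
Qed.

Section ghost_kernel.
Variables h0 c0 : nat.
Hypothesis hj : relevant L n h0 c0.

Let kpar : R.-pker (TreeM R Z L n) ~> Lt h0 := kprobability (measurable_parent h0 c0 hj).

Lemma tree_ghost_disintegration (f : TreeM R Z L n * Lt h0 -> \bar R) :
  (forall z, 0 <= f z) -> measurable_fun setT f ->
  \int[P]_om f (selT MT U om, ghost h0 c0 om) =
  \int[P]_om \int[(parent h0 c0 (selT MT U om) : probability (Lt h0) R)]_y
     f (selT MT U om, y).
Proof.
apply: (ge0_disintegration P (selT MT U : Om -> TreeM R Z L n) (ghost h0 c0) kpar tree_rects).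
- exact: measurable_selT.
- exact: measurable_ghost.
- exact: measurable_tree_rects.
- exact: tree_rects_setI.
- exact: tree_rects_setT.
- by move=> _ B [C mC <-] mB; rewrite preimage_tree_rect probability_ghost.
Qed.

Lemma measurable_fst_parent :
  measurable_fun setT (fst : TreeM R Z L n * Wsp -> TreeM R Z L n).
Proof. exact: measurable_fst. Qed.

(** This is the conditional independence of W and the ghost given the selected tree. On a rectangle
    that also constrains the ghost, the event W in B may be replaced by the factor K B, a function
    of the tree; the ghost is then averaged under its parent, and K B is turned back into the
    event. *)
Lemma ghost_disintegration (f : Wsp * Lt h0 -> \bar R) :
  (forall z, 0 <= f z) -> measurable_fun setT f ->
  \int[P]_om f (W om, ghost h0 c0 om) =
  \int[P]_om \int[(parent h0 c0 (selT MT U om) : probability (Lt h0) R)]_y f (W om, y).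
Proof.
move=> f0 mf.
apply: (ge0_disintegration P (fun om => (selT MT U om : TreeM R Z L n, W om)) (ghost h0 c0)
  (kernel_precomp kpar fst measurable_fst_parent)
  [set A `*` B | A in tree_rects & B in measurable] _ _ _ _ _ _
  (fun z => f (z.1.2, z.2))) => //.
- by apply: measurable_fun_pair => //; exact: measurable_selT.
- exact: measurable_ghost.
- exact: (measurable_prod_generated _ measurable_tree_rects tree_rects_setT).
- move=> _ _ [A1 GA1 [B1 mB1 <-]] [A2 GA2 [B2 mB2 <-]].
  by rewrite -setXI; exists (A1 `&` A2); [exact: tree_rects_setI|
    exists (B1 `&` B2) => //; exact: measurableI].
- by exists setT; [exact: tree_rects_setT|exists setT => //; rewrite setXTT].
- move=> _ G0 [_ [C mC <-] [B mB <-]] mG0.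
  have mN : measurable_rect (node_rect h0 c0 G0) by exact: measurable_node_rect.
  have mT : measurable (tree_rect C).
    by rewrite measurable_tree_rects; apply: sub_sigma_algebra; exists C.
  have -> : (fun om => (selT MT U om : TreeM R Z L n, W om)) @^-1` (tree_rect C `*` B) `&`
            ghost h0 c0 @^-1` G0 = tree_event C (node_rect h0 c0 G0) `&` W @^-1` B.
    rewrite tree_event_ghost// -preimage_tree_rect.
    by apply/seteqP; split => om /=; tauto.
  rewrite law_W_tree_event// tree_event_ghost// -preimage_tree_rect.
  rewrite integral_indic_mul [RHS]integral_indic_mul.
  have mK := measurable_kernel K B mB.
  have mp := measurable_eval_parent h0 c0 G0 hj mG0.
  transitivity (\int[P]_om ((\1_(tree_rect C) (selT MT U om : TreeM R Z L n))%:E *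
      (K (selT MT U om) B * (\1_G0 (ghost h0 c0 om))%:E))).
    apply: eq_integral => om _.
    rewrite !indicE in_setI -mulnb natrM EFinM -!muleA; congr (_ * _).
    by rewrite muleC.
  rewrite (tree_ghost_disintegration (fun z => (\1_(tree_rect C) z.1)%:E *
      (K z.1 B * (\1_G0 z.2)%:E))); last 2 first.
    by move=> z; rewrite !mule_ge0// lee_fin.
    apply: emeasurable_funM.
      apply/measurable_EFinP; apply: measurableT_comp => //; exact: measurable_indic.
    apply: emeasurable_funM; first exact: measurableT_comp mK measurable_fst.
    by apply/measurable_EFinP; apply: measurableT_comp => //; exact: measurable_indic.
  transitivity (\int[P]_om ((\1_(tree_rect C) (selT MT U om : TreeM R Z L n))%:E *
      ((parent h0 c0 (selT MT U om) : probability (Lt h0) R) G0 * (\1_B (W om))%:E))).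
    rewrite [RHS](tree_loss_disintegration (fun z => (\1_(tree_rect C) z.1)%:E *
      ((parent h0 c0 z.1 : probability (Lt h0) R) G0 * (\1_B z.2)%:E))); last 2 first.
      by move=> z; rewrite !mule_ge0// lee_fin.
      apply: emeasurable_funM.
        apply/measurable_EFinP; apply: measurableT_comp => //; exact: measurable_indic.
      apply: emeasurable_funM; first exact: measurableT_comp mp measurable_fst.
      by apply/measurable_EFinP; apply: measurableT_comp => //; exact: measurable_indic.
    apply: eq_integral => om _ /=.
    have m1 d (T : measurableType d) (A : set T) : measurable A ->
        measurable_fun setT (fun y => (\1_A y)%:E : \bar R).
      by move=> mA; exact/measurable_EFinP/measurable_indic.
    rewrite ge0_integralZl//; try by [apply: measurable_funeM; exact: m1|
      move=> y _; rewrite mule_ge0// lee_fin|rewrite lee_fin].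
    rewrite ge0_integralZl//; try by [exact: m1|move=> y _; rewrite lee_fin].
    rewrite [RHS]ge0_integralZl//; try by [apply: measurable_funeM; exact: m1|
      move=> y _; rewrite mule_ge0// lee_fin|rewrite lee_fin].
    rewrite [in RHS]ge0_integralZl//; try by [exact: m1|move=> y _; rewrite lee_fin].
    by rewrite !integral_indic// !setIT; congr (_ * _); rewrite muleC.
  apply: eq_integral => om _.
  rewrite !indicE.
  rewrite (_ : (om \in _) = (selT MT U om \in tree_rect C) && (W om \in B)); last first.
    apply/idP/andP => [/set_mem[/= ? ?]|[/set_mem ? /set_mem ?]]; last exact: mem_set.
    by rewrite !mem_set.
  by rewrite -mulnb natrM EFinM -!muleA; congr (_ * _); rewrite muleC.
- apply: measurableT_comp mf _; apply: measurable_fun_pair => //.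
  exact: measurableT_comp measurable_snd measurable_fst.
Qed.

End ghost_kernel.

(** * Independence of a selection bit from its pair *)

Lemma rectprob_node_below h0 c0 (A B : set (Lt h0)) h j x : (h <= h0)%N ->
  rectprob L n (node_rect h0 c0 A) (node_rect h0 c0 B) h j x = 1.
Proof.
elim: h => [//|h IH] in j x *; move=> hh; rewrite rectprobS big1// => r _.
have ne c : ~ (h = h0 /\ c = c0) by move=> [e _]; rewrite e ltnn in hh.
rewrite !node_rect_neq// probability_setT mul1e.
under eq_integral do rewrite IH ?(ltnW hh)//.
by rewrite integral_cst// mul1e; exact: probability_setT.
Qed.

(** Without constraints below [c0], its two roles contribute the product of the masses of [A] and
    [B] under the same parent, which is symmetric. *)
Lemma rectprob_node_swap h0 c0 (A B : set (Lt h0)) h j x :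
  measurable A -> measurable B ->
  rectprob L n (node_rect h0 c0 A) (node_rect h0 c0 B) h j x =
  rectprob L n (node_rect h0 c0 B) (node_rect h0 c0 A) h j x.
Proof.
move=> mA mB; elim: h => [//|h IH] in j x *; rewrite !rectprobS.
apply: eq_bigr => r _; set c := (_ + _)%N.
have [[hh cc]|ne] := pselect (h = h0 /\ c = c0); last first.
  by rewrite !node_rect_neq//; congr (_ * _); apply: eq_integral => y _; exact: IH.
move: x; rewrite cc hh => x; rewrite !node_rect_eq.
under eq_integral do rewrite rectprob_node_below//.
under [in RHS]eq_integral do rewrite rectprob_node_below//.
by rewrite !integral_cst// !mul1e muleC.
Qed.

Section selection_swap.
Variables h0 c0 : nat.
Hypothesis hj : relevant L n h0 c0.

Let MTs om := (MT h0 c0 false om, MT h0 c0 true om).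

Let mMTs : measurable_fun setT MTs.
Proof. by apply: measurable_fun_pair; exact: MT_meas. Qed.

Let mU b : measurable (U h0 c0 @^-1` [set b]).
Proof. by rewrite -[X in measurable X]setTI; exact: U_meas. Qed.

(** On a rectangle A x B of copies, changing the bit exchanges the roles of the copies; the bit has
    weight 1/2 either way, and [rectprob_node_swap] identifies the remaining factors. *)
Lemma selection_independent S : measurable S ->
  P (MTs @^-1` S `&` U h0 c0 @^-1` [set true]) =
  P (MTs @^-1` S `&` U h0 c0 @^-1` [set false]).
Proof.
pose m b := image_measure (mrestr P (mU b)) _ mMTs.
apply: (finite_measure_eq [set A `*` B | A in measurable & B in measurable] (m true) (m false)).
- by rewrite measurable_prod_measurableType.
- move=> _ _ [A1 mA1 [B1 mB1 <-]] [A2 mA2 [B2 mB2 <-]].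
  by rewrite -setXI; exists (A1 `&` A2); [exact: measurableI|
    exists (B1 `&` B2) => //; exact: measurableI].
- by exists setT => //; exists setT => //; rewrite setXTT.
- move=> _ [A mA [B mB <-]].
  change (P (MTs @^-1` (A `*` B) `&` U h0 c0 @^-1` [set true]) =
          P (MTs @^-1` (A `*` B) `&` U h0 c0 @^-1` [set false])).
  have mNA := measurable_node_rect h0 c0 A mA.
  have mNB := measurable_node_rect h0 c0 B mB.
  have mT : measurable_rect setT_rect by exact: measurable_setT_rect.
  have E b (A' B' : set (Lt h0)) :
      tree_event (node_rect h0 c0 A') (node_rect h0 c0 B') `&` U h0 c0 @^-1` [set b] =
      (MT h0 c0 b @^-1` A' `&` MT h0 c0 (~~ b) @^-1` B') `&` U h0 c0 @^-1` [set b].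
    rewrite tree_event_ghost//.
    rewrite (_ : node_rect h0 c0 A' = fun h j => setT_rect h j `&` node_rect h0 c0 A' h j); last first.
      apply: functional_extensionality_dep => h; apply/funext => j.
      by apply/seteqP; split => y //= -[].
    rewrite tree_event_node// tree_event_setT setTI.
    by apply/seteqP; split => om /= [[sA gB] Ub]; split => //; split; move: sA gB;
      rewrite /sel /selT /ghost Ub.
  rewrite (_ : MTs @^-1` (A `*` B) `&` U h0 c0 @^-1` [set true] =
     tree_event (node_rect h0 c0 B) (node_rect h0 c0 A) `&` U h0 c0 @^-1` [set true]).
    rewrite (_ : MTs @^-1` (A `*` B) `&` U h0 c0 @^-1` [set false] =
       tree_event (node_rect h0 c0 A) (node_rect h0 c0 B) `&` U h0 c0 @^-1` [set false]).
      rewrite !probability_tree_event_U// rectprob_node_swap//.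
    by rewrite E.
  by rewrite E; apply/seteqP; split => om /=; tauto.
- apply: (@le_lt_trans _ _ 1); last by rewrite ltry.
  apply: (@probability_le1 _ _ _ P); apply: measurableI => //.
  by rewrite preimage_setT; exact: measurableT.
Qed.

(** A set of triples has one slice for each value of the bit, and each slice has equal mass under
    both values. *)
Lemma integral_selection_swap (F : (Lt h0 * Lt h0) * bool -> \bar R) :
  (forall z, 0 <= F z) -> measurable_fun setT F ->
  \int[P]_om F (MTs om, U h0 c0 om) = \int[P]_om F (MTs om, ~~ U h0 c0 om).
Proof.
move=> F0 mF.
have mX : measurable_fun setT (fun om => (MTs om, U h0 c0 om)).
  by apply: measurable_fun_pair => //; exact: U_meas.
have mX' : measurable_fun setT (fun om => (MTs om, ~~ U h0 c0 om)).
  apply: measurable_fun_pair => //; apply: (measurable_fun_bool true); rewrite setTI.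
  rewrite (_ : _ @^-1` _ = U h0 c0 @^-1` [set false])//.
  by apply/seteqP; split => om /=; case: (U h0 c0 om).
transitivity (\int[image_measure P _ mX]_z F z); first by rewrite ge0_integral_pushforward.
transitivity (\int[image_measure P _ mX']_z F z); last by rewrite ge0_integral_pushforward.
apply: eq_measure_integral => S mS _.
change (P ((fun om => (MTs om, U h0 c0 om)) @^-1` S) =
        P ((fun om => (MTs om, ~~ U h0 c0 om)) @^-1` S)).
pose Sb b := [set p | S (p, b)].
have mSb b : measurable (Sb b).
  rewrite (_ : Sb b = (fun p => (p, b)) @^-1` S)// -[X in measurable X]setTI.
  exact: measurable_fun_pair.
have mI b b' : measurable (MTs @^-1` Sb b `&` U h0 c0 @^-1` [set b']).
  by apply: measurableI => //; rewrite -[X in measurable X]setTI; exact: mMTs.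
have dis A B : (MTs @^-1` A `&` U h0 c0 @^-1` [set true]) `&`
               (MTs @^-1` B `&` U h0 c0 @^-1` [set false]) = set0.
  by apply/seteqP; split => // om [[_ /= ->] []].
rewrite [in LHS](_ : _ @^-1` S = (MTs @^-1` Sb true `&` U h0 c0 @^-1` [set true]) `|`
                         (MTs @^-1` Sb false `&` U h0 c0 @^-1` [set false])); last first.
  apply/seteqP; split => om /=; rewrite /Sb /=; last by move=> [[+ ->]|[+ ->]].
  by case: (U h0 c0 om) => ?; [left|right].
rewrite [in RHS](_ : _ @^-1` S = (MTs @^-1` Sb false `&` U h0 c0 @^-1` [set true]) `|`
                         (MTs @^-1` Sb true `&` U h0 c0 @^-1` [set false])); last first.
  apply/seteqP; split => om /=; rewrite /Sb /=; last by move=> [[+ ->]|[+ ->]].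
  by case: (U h0 c0 om) => ?; [left|right].
rewrite !measureU// addeC; congr (_ + _); last exact: selection_independent.
by apply/esym; exact: selection_independent.
Qed.

End selection_swap.

End supersample.

(** * Nested expectations of nonnegative functions *)

Section hierarchical_expectation.
Context {R : realType} {dZ} {Z : measurableType dZ} {dW} {Wsp : measurableType dW}.
Local Notation Lt := (@Lt R dZ Z).
Local Open Scope ereal_scope.

Lemma EhierS h (nu : Lt h.+1) (f : Z -> \bar R) :
  Ehier nu f = \int[(nu : probability (Lt h) R)]_y Ehier y f.
Proof. by []. Qed.

Lemma Ehier_ge0 h (x : Lt h) (f : Z -> \bar R) :
  (forall z, 0 <= f z) -> 0 <= Ehier x f.
Proof.
by move=> f0; elim: h => [//|h IH] in x *; rewrite EhierS integral_ge0.
Qed.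

Lemma measurable_Ehier_pair (f : Wsp * Z -> \bar R) h :
  (forall p, 0 <= f p) -> measurable_fun setT f ->
  measurable_fun setT (fun p : Wsp * Lt h => Ehier p.2 (fun z => f (p.1, z))).
Proof.
move=> f0 mf; elim: h => [|h IH].
  by rewrite (_ : (fun _ => _) = f)//; apply/funext => -[].
have ms : measurable_fun setT (snd : Wsp * pprobability (Lt h) R -> pprobability (Lt h) R).
  exact: measurable_snd.
apply: (measurable_fun_integral_finite_kernel
  (fun q : (Wsp * Lt h.+1) * Lt h => Ehier q.2 (fun z => f (q.1.1, z))) (kprobability ms)).
  by move=> q; exact: Ehier_ge0.
have mg : measurable_fun setT (fun q : (Wsp * Lt h.+1) * Lt h => (q.1.1, q.2)).
  by apply: measurable_fun_pair => //; exact: measurableT_comp measurable_fst measurable_fst.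
exact: measurableT_comp IH mg.
Qed.

Lemma measurable_Ehier (f : Z -> \bar R) h :
  (forall z, 0 <= f z) -> measurable_fun setT f ->
  measurable_fun setT (fun y : Lt h => Ehier y f).
Proof.
move=> f0 mf; elim: h => [//|h IH].
by apply: measurable_pprobability_integral => // y; exact: Ehier_ge0.
Qed.

Lemma Ehier_cst h (x : Lt h) (c : \bar R) : Ehier x (fun=> c) = c.
Proof.
elim: h => [//|h IH] in x *; rewrite EhierS.
under eq_integral do rewrite IH.
by rewrite integral_cst// -[RHS]mule1; congr (_ * _); exact: probability_setT.
Qed.

Lemma le_Ehier h (x : Lt h) (f g : Z -> \bar R) :
  (forall z, 0 <= f z) -> (forall z, f z <= g z) -> Ehier x f <= Ehier x g.
Proof.
move=> f0 fg; elim: h => [//|h IH] in x *; rewrite !EhierS.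
by apply: ge0_le_integralr => // y; exact: Ehier_ge0.
Qed.

Lemma EhierD h (x : Lt h) (f g : Z -> \bar R) :
  (forall z, 0 <= f z) -> measurable_fun setT f ->
  (forall z, 0 <= g z) -> measurable_fun setT g ->
  Ehier x (fun z => f z + g z) = Ehier x f + Ehier x g.
Proof.
move=> f0 mf g0 mg; elim: h => [//|h IH] in x *; rewrite !EhierS.
under eq_integral do rewrite IH.
by rewrite ge0_integralD//; do 1?[by move=> y _; exact: Ehier_ge0];
  exact: measurable_Ehier.
Qed.

(** Carries the Lipschitz bound from the loss to its conditional means. The additive form avoids
    subtracting nested integrals. *)
Lemma Ehier_le_add h (x : Lt h) (f g : Z -> \bar R) (k : \bar R) :
  (forall z, 0 <= f z) -> (forall z, 0 <= g z) -> measurable_fun setT g -> 0 <= k ->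
  (forall z, f z <= g z + k) -> Ehier x f <= Ehier x g + k.
Proof.
move=> f0 g0 mg k0 fgk; rewrite -[X in _ + X](Ehier_cst _ x k) -EhierD//.
exact: le_Ehier.
Qed.

End hierarchical_expectation.

(** * The easy half of Kantorovich duality *)

Section wasserstein.
Context {R : realType} {dW} {Wsp : measurableType dW}.
Variable rho : Wsp -> Wsp -> R.
Hypothesis rho_meas : measurable_fun setT (fun p : Wsp * Wsp => rho p.1 p.2).
Hypothesis rho_ge0 : forall w w', 0 <= rho w w'.
Local Open Scope ereal_scope.

Lemma wass1_ge0 (p q : {measure set Wsp -> \bar R}) : 0 <= wass1 rho p q.
Proof.
by apply/ereal_infP => _ [pi _ <-]; apply: integral_ge0 => z _; rewrite lee_fin.
Qed.

Lemma integral_coupling_fst (p q : {measure set Wsp -> \bar R})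
    (pi : probability (Wsp * Wsp)%type R) (f : Wsp -> \bar R) :
  coupling p q pi -> (forall w, 0 <= f w) -> measurable_fun setT f ->
  \int[p]_w f w = \int[pi]_z f z.1.
Proof.
move=> pq f0 mf.
transitivity (\int[image_measure pi fst measurable_fst]_w f w).
  apply: eq_measure_integral => A mA _; have [<- _] := pq A mA.
  change (pi (A `*` setT) = pi (fst @^-1` A)); congr (pi _).
  by apply/seteqP; split => -[x y] //= [].
by rewrite ge0_integral_pushforward.
Qed.

Lemma integral_coupling_snd (p q : {measure set Wsp -> \bar R})
    (pi : probability (Wsp * Wsp)%type R) (f : Wsp -> \bar R) :
  coupling p q pi -> (forall w, 0 <= f w) -> measurable_fun setT f ->
  \int[q]_w f w = \int[pi]_z f z.2.
Proof.
move=> pq f0 mf.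
transitivity (\int[image_measure pi snd measurable_snd]_w f w).
  apply: eq_measure_integral => A mA _; have [_ <-] := pq A mA.
  change (pi (setT `*` A) = pi (snd @^-1` A)); congr (pi _).
  by apply/seteqP; split => -[x y] //= [].
by rewrite ge0_integral_pushforward.
Qed.

(** Under any coupling the difference is the mean of f(w) - f(w'), hence at most c times the
    transport cost; the infimum is taken afterwards. The bound [M] keeps the subtraction finite. *)
Lemma wass1_dual_le (p q : {measure set Wsp -> \bar R}) (f : Wsp -> \bar R) (c M : R) :
  p setT = 1 -> q setT = 1 -> (0 <= c)%R ->
  (forall w, 0 <= f w <= M%:E) -> measurable_fun setT f ->
  (forall w w', f w <= f w' + (c * rho w w')%:E) ->
  \int[p]_w f w - \int[q]_w f w <= c%:E * wass1 rho p q.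
Proof.
move=> p1 q1 c0 fM mf flip.
have f0 w : 0 <= f w by have /andP[] := fM w.
(* For c = 0 one cannot divide by c, but then [f] is constant and both sides vanish, even if the
   distance is infinite. *)
have [c00|cpos] := eqVneq c 0%R.
  have fcst w : f w = f point.
    by apply/eqP; rewrite eq_le; apply/andP; split;
      apply: le_trans (flip _ _) _; rewrite c00 mul0r adde0.
  rewrite c00 mul0e.
  under eq_integral do rewrite fcst.
  under [X in _ - X]eq_integral do rewrite fcst.
  by rewrite !integral_cst// [X in _ * X - _]p1 [X in _ - _ * X]q1 mule1 subee// ge0_fin_numE//;
    have /andP[_ /le_lt_trans] := fM point; apply; rewrite ltry.
have {cpos}cpos : (0 < c)%R by rewrite lt_neqAle eq_sym cpos.
have qfin : \int[q]_w f w \is a fin_num.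
  rewrite ge0_fin_numE ?integral_ge0//.
  apply: (@le_lt_trans _ _ (\int[q]_w (cst M%:E w))).
    by apply: ge0_le_integralr => // w; have /andP[] := fM w.
  by rewrite integral_cst// [X in _ * X]q1 mule1 ltry.
rewrite -lee_pdivrMl//; apply/ereal_infP => _ [pi pq <-].
rewrite lee_pdivrMl// leeBlDl//.
rewrite (integral_coupling_fst _ _ _ _ pq)// (integral_coupling_snd _ _ _ _ pq)//.
have mrho : measurable_fun setT (fun z : Wsp * Wsp => (rho z.1 z.2)%:E).
  exact/measurable_EFinP.
rewrite -ge0_integralZl//; last by move=> z _; rewrite lee_fin.
rewrite -ge0_integralD//.
- by apply: ge0_le_integralr => // z; rewrite -EFinM.
- exact: measurableT_comp mf measurable_snd.
- by move=> z _; rewrite mule_ge0// lee_fin.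
- exact: measurable_funeM.
Qed.

(** Replacing [f] by M - f reverses the sign and stays within [0, M]. Thus [p] and [q] keep their
    order, and symmetry of [wass1] is not called for. *)
Lemma wass1_dual_ge (p q : {measure set Wsp -> \bar R}) (f : Wsp -> \bar R) (c M : R) :
  p setT = 1 -> q setT = 1 -> (0 <= c)%R ->
  (forall w, 0 <= f w <= M%:E) -> measurable_fun setT f ->
  (forall w w', f w' <= f w + (c * rho w w')%:E) ->
  \int[q]_w f w - \int[p]_w f w <= c%:E * wass1 rho p q.
Proof.
move=> p1 q1 c0 fM mf flip.
have ffin w : f w \is a fin_num.
  by have /andP[f0 fm] := fM w; rewrite ge0_fin_numE// (le_lt_trans fm)// ltry.
pose g w := M%:E - f w.
have gM w : 0 <= g w <= M%:E.
  have /andP[f0 fm] := fM w; rewrite /g sube_ge0 ?ffin// fm/=.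
  by rewrite leeBlDr// leeDl.
have mg : measurable_fun setT g by apply: emeasurable_funB => //; exact: measurable_cst.
have gE (m : {measure set Wsp -> \bar R}) : m setT = 1 ->
    \int[m]_w g w + \int[m]_w f w = M%:E.
  move=> m1; rewrite -ge0_integralD//; last 2 first.
  - by move=> w _; have /andP[] := gM w.
  - by move=> w _; have /andP[] := fM w.
  under eq_integral do rewrite /g subeK//.
  by rewrite integral_cst// [X in _ * X]m1 mule1.
have glip w w' : g w <= g w' + (c * rho w w')%:E.
  have := flip w w'; rewrite /g; move: (ffin w) (ffin w').
  case: (f w) => [a||]//; case: (f w') => [b||]// _ _.
  by rewrite -!EFinB -!EFinD !lee_fin; lra.
have := wass1_dual_le p q g c M p1 q1 c0 gM mg glip.
have fi (m : {measure set Wsp -> \bar R}) : m setT = 1 -> \int[m]_w f w \is a fin_num.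
  move=> m1; rewrite ge0_fin_numE ?integral_ge0//; last by move=> w _; have /andP[] := fM w.
  apply: (@le_lt_trans _ _ M%:E); last by rewrite ltry.
  rewrite -(gE m m1) leeDr// integral_ge0// => w _; by have /andP[] := gM w.
apply: le_trans; have := gE p p1; have := gE q q1; move: (fi p p1) (fi q q1).
case: (\int[p]_w f w) => [a||]//; case: (\int[q]_w f w) => [b||]// _ _.
case: (\int[p]_w g w) => [a'||]//; case: (\int[q]_w g w) => [b'||]//.
by rewrite -!EFinD => -[e1] [e2]; rewrite lee_fin; lra.
Qed.

(** [v] may fail to be measurable, so the constant is not pulled out of its integral: the inverse of
    [c] is moved into the positive part of [H] instead. *)
Lemma integral_le_scaled {d} {Om : measurableType d} (P : {measure set Om -> \bar R})
    (H v : Om -> \bar R) (c : R) :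
  measurable_fun setT H -> (forall om, 0 <= v om) -> (0 <= c)%R ->
  (forall om, H om <= c%:E * v om) -> \int[P]_om H om <= c%:E * \int[P]_om v om.
Proof.
move=> mH v0 c0 Hv.
have HP : \int[P]_om H om <= \int[P]_om H^\+ om.
  rewrite integralE; apply: (@le_trans _ _ (\int[P]_om H^\+ om - 0)); last by rewrite sube0.
  by apply: leeB => //; exact: integral_ge0.
apply: le_trans HP _.
have [c00|cpos] := eqVneq c 0%R.
  rewrite c00 mul0e; under eq_integral.
    move=> om _; rewrite funeposE (max_idPr _); last by rewrite (le_trans (Hv om))// c00 mul0e.
    over.
  by rewrite integral0.
have {cpos}cpos : (0 < c)%R by rewrite lt_neqAle eq_sym cpos.
rewrite -lee_pdivrMl// -ge0_integralZl//; last 2 first.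
- exact: measurable_funepos.
- by rewrite lee_fin invr_ge0.
apply: ge0_le_integralr => om; first by rewrite mule_ge0// lee_fin invr_ge0.
by rewrite lee_pdivrMl// funeposE ge_max Hv mule_ge0.
Qed.

End wasserstein.

Lemma sum_divn (V : zmodType) (F : nat -> V) (m k : nat) : (0 < k)%N ->
  \sum_(j < m * k) F (j %/ k)%N = (\sum_(i < m) F i) *+ k.
Proof.
move=> k0; rewrite -(big_mkord xpredT (fun j => F (j %/ k)%N)) -(big_mkord xpredT F).
elim: m => [|m IH]; first by rewrite mul0n !big_geq// mul0rn.
rewrite mulSn addnC (@big_cat_nat _ _ _ (m * k))//= ?leq_addr// IH.
rewrite big_nat_recr//= mulrnDl; congr (_ + _).
rewrite -{1}[(m * k)%N]add0n big_addn addnC addnK.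
rewrite (eq_big_nat _ _ (F2 := fun=> F m)); last first.
  by move=> i /andP[_ ik]; rewrite addnC divnMDl// divn_small// addn0.
by rewrite sumr_const_nat subn0.
Qed.

Lemma bounded_ge0_integrable {R : realType} {d} {T : measurableType d}
    (P : probability T R) (f : T -> \bar R) (M : R) :
  measurable_fun setT f -> (forall x, 0 <= f x <= M%:E)%E -> P.-integrable setT f.
Proof.
move=> mf fM; apply/integrableP; split => //.
apply: (@le_lt_trans _ _ (\int[P]_x (cst M%:E x))%E).
  apply: ge0_le_integralr => // x; have /andP[f0 fM'] := fM x.
  by rewrite gee0_abs.
by rewrite integral_cst//= [X in (_ * X)%E]probability_setT mule1 ltry.
Qed.

Lemma probability_integral_le {R : realType} {d} {T : measurableType d}
    (P : {measure set T -> \bar R}) (f : T -> \bar R) (M : R) :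
  P setT = 1%E ->
  (forall x, 0 <= f x <= M%:E)%E -> (0 <= \int[P]_x f x <= M%:E)%E.
Proof.
move=> P1 fM; apply/andP; split; first by apply: integral_ge0 => x _; have /andP[] := fM x.
apply: (@le_trans _ _ (\int[P]_x (cst M%:E x))%E).
  by apply: ge0_le_integralr => x; have /andP[] := fM x.
by rewrite integral_cst//= [X in (_ * X)%E]P1 mule1.
Qed.

(** * The inequality for a bounded nonnegative loss *)

Section bounded_loss.
Context {R : realType} {dZ} {Z : measurableType dZ} {dW} {Wsp : measurableType dW}.
Variable rho : Wsp -> Wsp -> R.
Hypothesis rho_meas : measurable_fun setT (fun p : Wsp * Wsp => rho p.1 p.2).
Hypothesis rho_ge0 : forall w w', 0 <= rho w w'.
Hypothesis rho_sym : forall w w', rho w w' = rho w' w.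
Variables (L : nat) (n : nat -> nat).
Hypothesis n_ge1 : forall k, (1 <= k <= L)%N -> (1 <= n k)%N.
Local Notation Lt := (@Lt R dZ Z).
Variables (D : Lt L) (K : R.-pker (TreeM R Z L n) ~> Wsp).
Context {dO} {Om : measurableType dO}.
Variables (P : probability Om R) (MT : forall h : nat, nat -> bool -> Om -> Lt h)
  (U : nat -> nat -> Om -> bool) (W : Om -> Wsp).
Hypothesis MT_meas : forall h j b, relevant L n h j -> measurable_fun setT (MT h j b).
Hypothesis U_meas : forall h j, relevant L n h j -> measurable_fun setT (U h j).
Hypothesis W_meas : measurable_fun setT W.
Hypothesis law_tree : forall (A : forall h : nat, nat -> bool -> set (Lt h))
    (u : nat -> nat -> bool),
  (forall h j b, relevant L n h j -> measurable (A h j b)) ->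
  P (rectE L n MT U A u) =
    (((2^-1 : R) ^+ nnodes L n)%:E * @Grect R dZ Z L n A u L 0 D)%E.
Hypothesis law_W : forall (A : forall h : nat, nat -> bool -> set (Lt h))
    (u : nat -> nat -> bool) (B : set Wsp),
  (forall h j b, relevant L n h j -> measurable (A h j b)) -> measurable B ->
  P (rectE L n MT U A u `&` W @^-1` B) =
    (\int[P]_(om in rectE L n MT U A u) K (selT MT U om) B)%E.
Variables (kU : forall h : nat, nat -> R.-pker ((Lt h * Lt h) * bool)%type ~> Wsp)
  (k0 : forall h : nat, nat -> R.-pker (Lt h * Lt h)%type ~> Wsp).
Hypothesis kU_cond : forall h j, relevant L n h j ->
  forall (A : set ((Lt h * Lt h) * bool)%type) (B : set Wsp),
  measurable A -> measurable B ->
  P ([set om | A ((MT h j false om, MT h j true om), U h j om)] `&` W @^-1` B) =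
  (\int[P]_(om in [set om | A ((MT h j false om, MT h j true om), U h j om)])
     kU h j ((MT h j false om, MT h j true om), U h j om) B)%E.
Variables (loss : Wsp -> Z -> R) (c M : R).
Hypothesis loss_meas : measurable_fun setT (fun p : Wsp * Z => loss p.1 p.2).
Hypothesis loss_bound : forall w z, 0 <= loss w z <= M.
Hypothesis c_ge0 : 0 <= c.
Hypothesis loss_lip : forall w w' z, loss w z <= loss w' z + c * rho w w'.
Local Open Scope ereal_scope.

(** The mean loss of [w] on fresh data drawn below [y]; this is the quantity telescoped over the
    heights. *)
Let Phi h (w : Wsp) (y : Lt h) : \bar R := Ehier y (fun z => (loss w z)%:E).

Let mloss : measurable_fun setT (fun p : Wsp * Z => (loss p.1 p.2)%:E).
Proof. exact/measurable_EFinP. Qed.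

Let loss_ge0 w z : 0 <= (loss w z)%:E.
Proof. by rewrite lee_fin; have /andP[] := loss_bound w z. Qed.

Let Phi_bound h w (y : Lt h) : 0 <= Phi h w y <= M%:E.
Proof.
rewrite Ehier_ge0//= -(Ehier_cst h y M%:E) le_Ehier// => z.
by rewrite lee_fin; have /andP[] := loss_bound w z.
Qed.

Let Phi_ge0 h w (y : Lt h) : 0 <= Phi h w y.
Proof. by have /andP[] := Phi_bound h w y. Qed.

Let mPhi h : measurable_fun setT (fun p : Wsp * Lt h => Phi h p.1 p.2).
Proof. by apply: (measurable_Ehier_pair (fun p => (loss p.1 p.2)%:E)). Qed.

Let Phi_lip h w w' (y : Lt h) : Phi h w y <= Phi h w' y + (c * rho w w')%:E.
Proof.
apply: Ehier_le_add => //.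
- exact: (measurable_fun_pair2 w' mloss).
- by rewrite lee_fin mulr_ge0.
- by move=> z; rewrite -EFinD lee_fin.
Qed.

Section one_node.
Variables h j : nat.
Hypothesis hj : relevant L n h j.

Let X om := ((MT h j false om, MT h j true om), U h j om).

Let mX : measurable_fun setT X.
Proof.
apply: measurable_fun_pair; last exact: U_meas.
by apply: measurable_fun_pair; exact: MT_meas.
Qed.

Let kU_disintegration (f : ((Lt h * Lt h) * bool) * Wsp -> \bar R) :
  (forall z, 0 <= f z) -> measurable_fun setT f ->
  \int[P]_om f (X om, W om) = \int[P]_om \int[kU h j (X om)]_w f (X om, w).
Proof.
apply: (ge0_disintegration P X W (kU h j) measurable) => //.
- by rewrite smallest_id//; exact: sigma_algebra_measurable.
- by move=> A B mA mB; exact: measurableI.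
- by move=> A B mA mB; exact: kU_cond.
Qed.

(** As functions of the pair and the bit, [pick false] is the selected node and [pick true] the
    ghost. *)
Let pick (b : bool) (x : (Lt h * Lt h) * bool) : Lt h :=
  if x.2 (+) b then x.1.2 else x.1.1.

Let mpick b : measurable_fun setT (pick b).
Proof.
have m1 : measurable_fun setT (fun x : (Lt h * Lt h) * bool => x.1.1).
  exact: measurableT_comp measurable_fst measurable_fst.
have m2 : measurable_fun setT (fun x : (Lt h * Lt h) * bool => x.1.2).
  exact: measurableT_comp measurable_snd measurable_fst.
rewrite (_ : pick b = if b then (fun x => if x.2 then x.1.1 else x.1.2)
                      else (fun x => if x.2 then x.1.2 else x.1.1)).
  by case: b; apply: measurable_fun_ifT => //; exact: measurable_snd.
by apply/funext => -[p u]; rewrite /pick /=; case: b; case: u.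
Qed.

(** The mean of [Phi] at the picked node when W is drawn given the pair and the bit; in [B] it is
    drawn given the pair alone. *)
Let A b x := \int[kU h j x]_w Phi h w (pick b x).
Let B b (x : (Lt h * Lt h) * bool) := \int[k0 h j x.1]_w Phi h w (pick b x).

Let mf b : measurable_fun setT
  (fun z : ((Lt h * Lt h) * bool) * Wsp => Phi h z.2 (pick b z.1)).
Proof.
have m : measurable_fun setT (fun z : ((Lt h * Lt h) * bool) * Wsp => (z.2, pick b z.1)).
  by apply: measurable_fun_pair => //; exact: measurableT_comp (mpick b) measurable_fst.
exact: measurableT_comp (mPhi h) m.
Qed.

Let mA b : measurable_fun setT (A b).
Proof.
by apply: (measurable_fun_integral_finite_kernel
  (fun z : ((Lt h * Lt h) * bool) * Wsp => Phi h z.2 (pick b z.1)) (kU h j)).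
Qed.

Let mB b : measurable_fun setT (B b).
Proof.
by apply: (measurable_fun_integral_finite_kernel
  (fun z : ((Lt h * Lt h) * bool) * Wsp => Phi h z.2 (pick b z.1))
  (kernel_precomp (k0 h j) fst measurable_fst)).
Qed.

Let A_bound b x : 0 <= A b x <= M%:E.
Proof. by apply: probability_integral_le => //; exact: prob_kernel. Qed.

Let B_bound b x : 0 <= B b x <= M%:E.
Proof. by apply: probability_integral_le => //; exact: prob_kernel. Qed.

Let iA b : P.-integrable setT (A b \o X).
Proof.
apply: (@bounded_ge0_integrable _ _ _ P (A b \o X) M); last by move=> om; exact: A_bound.
exact: measurableT_comp (mA b) mX.
Qed.

Let iB b : P.-integrable setT (B b \o X).
Proof.
apply: (@bounded_ge0_integrable _ _ _ P (B b \o X) M); last by move=> om; exact: B_bound.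
exact: measurableT_comp (mB b) mX.
Qed.

Lemma node_gap_le :
  \int[P]_om Phi h (W om) (ghost MT U h j om) -
    \int[P]_om Phi h (W om) (selT MT U om h j) <=
  (2 * c)%:E * \int[P]_om wass1 rho (kU h j (X om)) (k0 h j (X om).1).
Proof.
have sE om : selT MT U om h j = pick false (X om).
  by rewrite /selT /pick /X /= addbF; case: (U h j om).
have gE om : ghost MT U h j om = pick true (X om).
  by rewrite /ghost /pick /X /= addbT; case: (U h j om).
under eq_integral do rewrite gE.
under [X in _ - X]eq_integral do rewrite sE.
rewrite (kU_disintegration (fun z => Phi h z.2 (pick true z.1)))//.
rewrite (kU_disintegration (fun z => Phi h z.2 (pick false z.1)))//.
(* The kernel in [B] ignores the bit, so flipping it only exchanges the selected node and the
   ghost. *)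
have BE : \int[P]_om B false (X om) = \int[P]_om B true (X om).
  rewrite (integral_selection_swap L n D P MT U MT_meas U_meas law_tree h j hj (B false))//.
    apply: eq_integral => om _; rewrite /B /pick /X /= addbF addbT.
    by case: (U h j om).
  by move=> z; have /andP[] := B_bound false z.
have fin b : \int[P]_om A b (X om) \is a fin_num by exact: (integrable_fin_num _ (iA b)).
have finB b : \int[P]_om B b (X om) \is a fin_num by exact: (integrable_fin_num _ (iB b)).
(* By [BE], the [B] terms can be inserted for free. They split the difference into two terms with
   the same node and different laws of W, each at most c times [wass1]: this is the factor 2. *)
have -> : \int[P]_om A true (X om) - \int[P]_om A false (X om) =
  \int[P]_om ((A true (X om) - B true (X om)) + (B false (X om) - A false (X om))).
  have iA' b : P.-integrable setT (fun om => A b (X om)) := iA b.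
  have iB' b : P.-integrable setT (fun om => B b (X om)) := iB b.
  rewrite (integralD measurableT (integrableB measurableT (iA' true) (iB' true))
    (integrableB measurableT (iB' false) (iA' false))).
  rewrite (integralB measurableT (iA' true) (iB' true)).
  rewrite (integralB measurableT (iB' false) (iA' false)) BE.
  move: (fin true) (fin false) (finB true).
  move: (\int[P]_om A true _) (\int[P]_om A false _) (\int[P]_om B true _).
  by move=> [x||] [y||] [z||]//= _ _ _; rewrite -!EFinB -EFinD; congr EFin; ring.
apply: integral_le_scaled.
- apply: emeasurable_funD; apply: emeasurable_funB;
    by [exact: measurableT_comp (mA _) mX|exact: measurableT_comp (mB _) mX].
- by move=> om; exact: wass1_ge0.
- by rewrite mulr_ge0.
move=> om.
have p1 : kU h j (X om) setT = 1 by exact: prob_kernel.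
have q1 : k0 h j (X om).1 setT = 1 by exact: prob_kernel.
rewrite mulr_natl mulr2n EFinD ge0_muleDl ?lee_fin//; apply: leeD.
  apply: (wass1_dual_le rho rho_meas rho_ge0 (kU h j (X om)) (k0 h j (X om).1)
    (fun w => Phi h w (pick true (X om))) c M) => //.
  exact: (measurable_fun_pair1 (pick true (X om)) (mPhi h)).
apply: (wass1_dual_ge rho rho_meas rho_ge0 (kU h j (X om)) (k0 h j (X om).1)
    (fun w => Phi h w (pick false (X om))) c M) => //.
  exact: (measurable_fun_pair1 (pick false (X om)) (mPhi h)).
by move=> w w'; rewrite rho_sym.
Qed.

End one_node.

Let ext h j om : Lt h := node_value L D h j (selT MT U om).

Let alpha h j := \int[P]_om Phi h (W om) (ext h j om).

Let alphaE h j : (fine (alpha h j))%:E = alpha h j.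
Proof.
have /andP[a0 aM] : 0 <= alpha h j <= M%:E.
  by apply: probability_integral_le => //; exact: probability_setT.
by rewrite fineK// ge0_fin_numE// (le_lt_trans aM)// ltry.
Qed.

(** [Phi] at the parent is by definition the integral of [Phi h] under the parent, which is the law
    of the ghost given the tree and W. *)
Let alpha_parent h j : relevant L n h j ->
  alpha h.+1 (j %/ n (L - h))%N = \int[P]_om Phi h (W om) (ghost MT U h j om).
Proof.
move=> hj.
rewrite (ghost_disintegration L n n_ge1 D K P MT U W MT_meas U_meas W_meas law_tree law_W
  h j hj (fun p => Phi h p.1 p.2))//.
Qed.

Let N h : R := (Nl n (L - h))%:R.

(** Average over the nodes at height h: [beta L] is the expected population risk and [beta 0] the
    expected empirical risk. *)
Let beta h : R := ((N h)^-1 * \sum_(j < Nl n (L - h)) fine (alpha h j))%R.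

Let beta_step h : (h < L)%N ->
  (beta h.+1 - beta h)%:E = (N h)^-1%:E * \sum_(j < Nl n (L - h))
    (\int[P]_om Phi h (W om) (ghost MT U h j om) -
     \int[P]_om Phi h (W om) (selT MT U om h j)).
Proof.
move=> hL.
have NE : Nl n (L - h) = (Nl n (L - h.+1) * n (L - h))%N.
  by rewrite (subnS_lt L h hL) NlS.
have n0 : (0 < n (L - h))%N by exact: branching_gt0.
(* Each parent is counted once per child, so that both levels are averaged over the same nodes. *)
have -> : beta h.+1 = ((N h)^-1 *
    \sum_(j < Nl n (L - h)) fine (alpha h.+1 (j %/ n (L - h))%N))%R.
  rewrite /beta /N NE (sum_divn _ (fun i => fine (alpha h.+1 i)))//.
  rewrite natrM -[X in (_ = _ * X)%R]mulr_natl invfM -mulrA; congr (_ * _)%R.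
  by rewrite mulKf// pnatr_eq0 -lt0n.
rewrite /beta -mulrBr -sumrB EFinM -sumEFin; congr (_ * _).
apply: eq_bigr => j _; have hj : relevant L n h j by split => /=.
rewrite EFinB !alphaE alpha_parent//; congr (_ - _).
by apply: eq_integral => om _; rewrite /ext node_value_lt.
Qed.

Hypothesis L_ge1 : (1 <= L)%N.

Let mloss_sel (j : 'I_(Nl n L)) :
  measurable_fun setT (fun om => (loss (W om) (selT MT U om 0%N j))%:E).
Proof.
have m : measurable_fun setT (fun om => (W om, selT MT U om 0%N j)).
  apply: measurable_fun_pair => //.
  by apply: (measurable_sel L n MT U MT_meas U_meas); split => //; rewrite subn0.
exact: measurableT_comp mloss m.
Qed.

Let LhatE om : (Lhat L n loss (W om) (selT MT U om))%:E =
  (N 0)^-1%:E * \sum_(j < Nl n L) (loss (W om) (selT MT U om 0%N j))%:E.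
Proof. by rewrite sumEFin -EFinM /N subn0. Qed.

Let integral_Lhat :
  \int[P]_om (Lhat L n loss (W om) (selT MT U om))%:E = (beta 0)%:E.
Proof.
under eq_integral do rewrite LhatE.
rewrite ge0_integralZl//; last 3 first.
- by apply: emeasurable_sum => j; exact: mloss_sel.
- by move=> om _; exact: sume_ge0.
- by rewrite lee_fin invr_ge0 ler0n.
rewrite ge0_integral_sum// /beta EFinM -sumEFin subn0; congr (_ * _).
apply: eq_bigr => j _; rewrite alphaE; apply: eq_integral => om _.
by rewrite /ext node_value_lt.
Qed.

Lemma bounded_gap_le :
  \int[P]_om (Lpop D loss (W om) - (Lhat L n loss (W om) (selT MT U om))%:E) <=
  (2 * c)%:E * \sum_(h < L) ((Nl n (L - h))%:R^-1%:E * \sum_(j < Nl n (L - h))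
     `| \int[P]_om wass1 rho
          (kU h j ((MT h j false om, MT h j true om), U h j om))
          (k0 h j (MT h j false om, MT h j true om)) |).
Proof.
rewrite integralB//; last 2 first.
- apply: (@bounded_ge0_integrable _ _ _ P _ M); last by move=> om; exact: Phi_bound.
  exact: measurableT_comp (measurable_fun_pair1 D (mPhi L)) W_meas.
- apply/integrableP; split.
    under eq_fun do rewrite LhatE.
    by apply: measurable_funeM; apply: emeasurable_sum => j; exact: mloss_sel.
  under eq_integral.
    move=> om _; rewrite gee0_abs; last first.
      by rewrite LhatE mule_ge0 ?sume_ge0// lee_fin invr_ge0 ler0n.
    over.
  by rewrite integral_Lhat ltry.
rewrite integral_Lhat.
have -> : \int[P]_om Lpop D loss (W om) = (beta L)%:E.
  rewrite /beta /N subnn (_ : Nl n 0 = 1%N); last by rewrite /Nl big_geq.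
  rewrite big_ord1 invr1 mul1r alphaE; apply: eq_integral => om _.
  by rewrite /ext node_value_root.
rewrite -EFinB -(telescope_sumr _ (leq0n L)) big_mkord -sumEFin.
rewrite ge0_sume_distrr; last first.
  by move=> h _; rewrite mule_ge0 ?sume_ge0// lee_fin invr_ge0 ler0n.
apply: lee_sum => h _; rewrite beta_step//.
rewrite muleCA; apply: lee_wpmul2l; first by rewrite lee_fin invr_ge0 ler0n.
rewrite ge0_sume_distrr//; apply: lee_sum => j _.
have hj : relevant L n h j by split => /=.
apply: le_trans (node_gap_le h j hj) _.
apply: lee_wpmul2l; first by rewrite lee_fin mulr_ge0.
exact: lee_abs.
Qed.

End bounded_loss.

Lemma measurable_pprobability_integral_signed {R : realType} {d}
    {T : measurableType d} (f : T -> \bar R) : measurable_fun setT f ->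
  measurable_fun setT
    (fun x : pprobability T R => \int[(x : probability T R)]_y f y)%E.
Proof.
move=> mf; under eq_fun do rewrite integralE.
by apply: emeasurable_funB; apply: measurable_pprobability_integral => //;
  [exact: measurable_funepos|exact: measurable_funeneg].
Qed.

(** * Every leaf has the law of fresh data from D *)

Section leaf_law.
Context {R : realType} {dZ} {Z : measurableType dZ} {dW} {Wsp : measurableType dW}.
Variables (L : nat) (n : nat -> nat).
Hypothesis n_ge1 : forall k, (1 <= k <= L)%N -> (1 <= n k)%N.
Local Notation Lt := (@Lt R dZ Z).
Variables (D : Lt L) (K : R.-pker (TreeM R Z L n) ~> Wsp).
Context {dO} {Om : measurableType dO}.
Variables (P : probability Om R) (MT : forall h : nat, nat -> bool -> Om -> Lt h)
  (U : nat -> nat -> Om -> bool) (W : Om -> Wsp).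
Hypothesis MT_meas : forall h j b, relevant L n h j -> measurable_fun setT (MT h j b).
Hypothesis U_meas : forall h j, relevant L n h j -> measurable_fun setT (U h j).
Hypothesis W_meas : measurable_fun setT W.
Hypothesis law_tree : forall (A : forall h : nat, nat -> bool -> set (Lt h))
    (u : nat -> nat -> bool),
  (forall h j b, relevant L n h j -> measurable (A h j b)) ->
  P (rectE L n MT U A u) =
    (((2^-1 : R) ^+ nnodes L n)%:E * @Grect R dZ Z L n A u L 0 D)%E.
Hypothesis law_W : forall (A : forall h : nat, nat -> bool -> set (Lt h))
    (u : nat -> nat -> bool) (B : set Wsp),
  (forall h j b, relevant L n h j -> measurable (A h j b)) -> measurable B ->
  P (rectE L n MT U A u `&` W @^-1` B) =
    (\int[P]_(om in rectE L n MT U A u) K (selT MT U om) B)%E.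
Local Open Scope ereal_scope.

(** Flipping the bit gives the selected node the same law as its ghost, whose law given the tree is
    the parent. *)
Lemma ge0_integral_sel_parent h j (g : Lt h -> \bar R) : relevant L n h j ->
  (forall y, 0 <= g y) -> measurable_fun setT g ->
  \int[P]_om g (selT MT U om h j) =
  \int[P]_om \int[(parent L n D h j (selT MT U om) : probability (Lt h) R)]_y g y.
Proof.
move=> hj g0 mg.
rewrite -(ghost_disintegration L n n_ge1 D K P MT U W MT_meas U_meas W_meas law_tree law_W
  h j hj (fun p => g p.2))//; last exact: measurableT_comp mg measurable_snd.
pose F (z : (Lt h * Lt h) * bool) := g (if z.2 then z.1.2 else z.1.1).
have mF : measurable_fun setT F.
  apply: measurableT_comp mg _; apply: measurable_fun_ifT; first exact: measurable_snd.
    exact: measurableT_comp measurable_snd measurable_fst.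
  exact: measurableT_comp measurable_fst measurable_fst.
have F0 z : 0 <= F z by exact: g0.
have := integral_selection_swap L n D P MT U MT_meas U_meas law_tree h j hj F F0 mF.
rewrite (_ : (\int[P]_om F (_, U h j om)) = \int[P]_om g (selT MT U om h j)).
  move=> ->; apply: eq_integral => om _; rewrite /F /ghost /=.
  by case: (U h j om).
apply: eq_integral => om _; rewrite /F /selT /=.
by case: (U h j om).
Qed.

Lemma measurable_Ehier_signed (f : Z -> \bar R) h : measurable_fun setT f ->
  measurable_fun setT (fun y : Lt h => Ehier y f).
Proof.
move=> mf; elim: h => [//|h IH].
exact: measurable_pprobability_integral_signed.
Qed.

Lemma abse_Ehier_le h (x : Lt h) (f : Z -> \bar R) : measurable_fun setT f ->
  `|Ehier x f| <= Ehier x (abse \o f).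
Proof.
move=> mf; elim: h => [//|h IH] in x *; rewrite !EhierS.
apply: (@le_trans _ _ (\int[(x : probability (Lt h) R)]_y `|Ehier y f|)).
  by apply: le_abse_integral => //; exact: measurable_Ehier_signed.
by apply: ge0_le_integralr.
Qed.

(** Induction on the distance [k] to the root: averaging a node under its parent moves the nested
    expectation one level up. *)
Lemma ge0_integral_Ehier_node (f : Z -> \bar R) : (forall z, 0 <= f z) ->
  measurable_fun setT f -> forall k h j, (h + k = L)%N -> (j < Nl n (L - h))%N ->
  \int[P]_om Ehier (node_value L D h j (selT MT U om)) f = Ehier D f.
Proof.
move=> f0 mf; elim=> [|k IH] h j hkL jN.
  rewrite addn0 in hkL; subst h.
  under eq_integral do rewrite node_value_root.
  by rewrite integral_cst//= [X in _ * X]probability_setT mule1.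
have hL : (h < L)%N by rewrite -hkL addnS ltnS leq_addr.
have hj : relevant L n h j by [].
under eq_integral do rewrite node_value_lt//.
rewrite (ge0_integral_sel_parent h j (fun y => Ehier y f) hj)//.
- have hkL' : (h.+1 + k = L)%N by rewrite addSn -addnS.
  apply: (IH h.+1 (j %/ n (L - h))%N hkL').
  by rewrite (ltn_parent L n n_ge1).
- by move=> y; exact: Ehier_ge0.
- exact: measurable_Ehier.
Qed.

Lemma measurable_node_value h j : (j < Nl n (L - h))%N -> (h <= L)%N ->
  measurable_fun setT (fun om => node_value L D h j (selT MT U om)).
Proof.
move=> jN; rewrite leq_eqVlt => /predU1P[hL|hL].
  subst h; rewrite (_ : (fun _ => _) = cst D); first exact: measurable_cst.
  by apply/funext => om; rewrite node_value_root.
rewrite (_ : (fun _ => _) = fun om => selT MT U om h j).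
  by apply: (measurable_sel L n MT U MT_meas U_meas).
by apply/funext => om; rewrite node_value_lt.
Qed.

Section integrable_leaf.
Variable f : Z -> \bar R.
Hypothesis mf : measurable_fun setT f.
Hypothesis f_fin : Ehier D (abse \o f) < +oo.

Let fa0 z : 0 <= (abse \o f) z. Proof. exact: abse_ge0. Qed.

Let mfa : measurable_fun setT (abse \o f). Proof. exact: measurableT_comp. Qed.

Lemma integrable_Ehier_node k h j : (h + k = L)%N -> (j < Nl n (L - h))%N ->
  P.-integrable setT (fun om => Ehier (node_value L D h j (selT MT U om)) f).
Proof.
move=> hkL jN; apply/integrableP; split.
  apply: measurableT_comp (measurable_Ehier_signed f h mf) _.
  by apply: measurable_node_value => //; rewrite -hkL leq_addr.
apply: le_lt_trans f_fin.
rewrite -(ge0_integral_Ehier_node (abse \o f) fa0 mfa k h j hkL jN).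
by apply: ge0_le_integralr => // om; exact: abse_Ehier_le.
Qed.

(** A signed nested integral takes positive and negative parts of the inner integral at each level.
    The splitting is therefore applied to [Ehier y f] at the current level and not to [f]. *)
Lemma integral_Ehier_node k h j : (h + k = L)%N -> (j < Nl n (L - h))%N ->
  \int[P]_om Ehier (node_value L D h j (selT MT U om)) f = Ehier D f.
Proof.
elim: k h j => [|k IH] h j hkL jN.
  rewrite addn0 in hkL; subst h.
  under eq_integral do rewrite node_value_root.
  by rewrite integral_cst//= [X in _ * X]probability_setT mule1.
have hL : (h < L)%N by rewrite -hkL addnS ltnS leq_addr.
have hj : relevant L n h j by [].
have hkL' : (h.+1 + k = L)%N by rewrite addSn -addnS.
have jN' : (j %/ n (L - h) < Nl n (L - h.+1))%N by rewrite (ltn_parent L n n_ge1).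
rewrite -(IH h.+1 (j %/ n (L - h))%N hkL' jN').
have mg : measurable_fun setT (fun y : Lt h => Ehier y f) by exact: measurable_Ehier_signed.
have iabs : \int[P]_om \int[(parent L n D h j (selT MT U om) : probability (Lt h) R)]_y
    `|Ehier y f| < +oo.
  apply: le_lt_trans f_fin.
  rewrite -(ge0_integral_Ehier_node (abse \o f) fa0 mfa k h.+1 _ hkL' jN').
  apply: ge0_le_integralr => om; first exact: integral_ge0.
  by apply: ge0_le_integralr => // y; exact: abse_Ehier_le.
have part (g : Lt h -> \bar R) : (forall y, 0 <= g y) -> measurable_fun setT g ->
    (forall y, g y <= `|Ehier y f|) ->
    P.-integrable setT (fun om =>
      \int[(parent L n D h j (selT MT U om) : probability (Lt h) R)]_y g y).
  move=> g0 mg' gf; apply/integrableP; split.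
    exact: measurableT_comp (measurable_pprobability_integral _ _ measurableT g0 mg')
      (measurableT_comp (measurable_parent L n n_ge1 D h j hj)
        (measurable_selT L n MT U MT_meas U_meas)).
  apply: le_lt_trans iabs; apply: ge0_le_integralr => // om.
  by rewrite gee0_abs ?integral_ge0//; exact: ge0_le_integralr.
pose g y := Ehier (y : Lt h) f.
have gp y : g^\+ y <= `|Ehier y f|.
  by rewrite -[leRHS]/((abse \o g) y) fune_abse leeDl.
have gn y : g^\- y <= `|Ehier y f|.
  by rewrite -[leRHS]/((abse \o g) y) fune_abse leeDr.
have mgp : measurable_fun setT g^\+ by exact: measurable_funepos.
have mgn : measurable_fun setT g^\- by exact: measurable_funeneg.
under eq_integral do rewrite node_value_lt//.
transitivity (\int[P]_om
  (\int[(parent L n D h j (selT MT U om) : probability (Lt h) R)]_y g^\+ y -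
   \int[(parent L n D h j (selT MT U om) : probability (Lt h) R)]_y g^\- y)).
  rewrite (integralB measurableT (part _ _ mgp gp) (part _ _ mgn gn))//.
  rewrite -(ge0_integral_sel_parent h j g^\+ hj)//.
  rewrite -(ge0_integral_sel_parent h j g^\- hj)//.
  rewrite [LHS]integralE; congr (_ - _); apply: eq_integral => om _;
    by rewrite ?funeposE ?funenegE.
by apply: eq_integral => om _; rewrite [RHS]integralE.
Qed.

Lemma integrable_leaf j : (0 < L)%N -> (j < Nl n L)%N ->
  P.-integrable setT (fun om => f (selT MT U om 0%N j)).
Proof.
move=> L0 jN; have := integrable_Ehier_node L 0 j (add0n L).
rewrite subn0 => /(_ jN); congr (P.-integrable _ _).
by apply/funext => om; rewrite node_value_lt.
Qed.

Lemma integral_leaf j : (0 < L)%N -> (j < Nl n L)%N ->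
  \int[P]_om f (selT MT U om 0%N j) = Ehier D f.
Proof.
move=> L0 jN; rewrite -(integral_Ehier_node L 0 j (add0n L)) ?subn0//.
by apply: eq_integral => om _; rewrite node_value_lt.
Qed.

End integrable_leaf.

End leaf_law.

(** * The logarithmic cutoff *)

Section cutoff.
Context {R : realType}.

(* The logarithm makes the slope at [r] at most [e / r]: multiplying by the cutoff
   a function that is bounded by [lam * r] and [lam]-Lipschitz makes it bounded,
   while its Lipschitz constant grows only by the factor [1 + e]. *)
Definition cutoff (e r : R) : R := maxr 0 (1 - e * ln (1 + r)).

Lemma cutoff_ge0 e r : 0 <= cutoff e r.
Proof. by rewrite /cutoff le_max lexx. Qed.

Lemma ln1D_ge0 (r : R) : 0 <= r -> 0 <= ln (1 + r).
Proof. by move=> r0; rewrite ln_ge0// lerDl. Qed.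

Lemma cutoff_le1 e r : 0 <= e -> 0 <= r -> cutoff e r <= 1.
Proof.
by move=> e0 r0; rewrite /cutoff ge_max ler01/= gerBl mulr_ge0// ln1D_ge0.
Qed.

(** The cutoff vanishes as soon as ln (1 + r) reaches 1 / e, that is, where 1 + r reaches exp (1 /
    e). *)
Lemma cutoff_mul_le e r : 0 < e -> 0 <= r -> cutoff e r * r <= expR e^-1.
Proof.
move=> e0 r0; have [c0|] := lerP (1 - e * ln (1 + r)) 0.
  by rewrite /cutoff (max_idPl c0) mul0r expR_ge0.
rewrite subr_gt0 -ltr_pdivlMl// mulr1 => lt.
apply: (@le_trans _ _ r); first by rewrite ler_piMl// cutoff_le1// ltW.
apply: (@le_trans _ _ (1 + r)); first by rewrite lerDr.
by rewrite -[leLHS]lnK ?ler_expR ?(ltW lt)// posrE ltr_pwDl.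
Qed.

Lemma cutoff_le e r r' : 0 <= e -> 0 <= r <= r' -> cutoff e r' <= cutoff e r.
Proof.
move=> e0 /andP[r0 rr']; rewrite /cutoff ge_max le_max lexx/= le_max; apply/orP; right.
by rewrite lerB// ler_wpM2l// ler_ln ?posrE ?ltr_pwDl ?(le_trans r0)// lerD2l.
Qed.

(** The increment of the logarithm is at most (r' - r) / (1 + r), and the factor [r] is absorbed by
    the denominator. *)
Lemma cutoff_slope e r r' : 0 <= e -> 0 <= r <= r' ->
  r * (cutoff e r - cutoff e r') <= e * (r' - r).
Proof.
move=> e0 /andP[r0 rr'].
have d1 : 0 < 1 + r by rewrite ltr_pwDl.
have le1 : cutoff e r - cutoff e r' <= e * (ln (1 + r') - ln (1 + r)).
  have ge : ln (1 + r) <= ln (1 + r').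
    by rewrite ler_ln ?posrE ?ltr_pwDl ?(le_trans r0)// lerD2l.
  have := mulr_ge0 e0; move/(_ (ln (1 + r') - ln (1 + r))); rewrite subr_ge0 => /(_ ge) ge'.
  rewrite /cutoff /maxr; do 2 case: ifP => ?; lra.
have le2 : ln (1 + r') - ln (1 + r) <= (r' - r) / (1 + r).
  rewrite -ln_div ?posrE ?ltr_pwDl ?(le_trans r0)//.
  have -> : (1 + r') / (1 + r) = 1 + (r' - r) / (1 + r) by field; lra.
  apply: le_ln1Dx; apply: (@lt_le_trans _ _ 0); first by rewrite ltrN10.
  by rewrite divr_ge0 ?subr_ge0// ltW.
apply: (@le_trans _ _ (r * (e * ((r' - r) / (1 + r))))).
  by apply: ler_wpM2l => //; apply: le_trans le1 _; exact: ler_wpM2l.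
have -> : r * (e * ((r' - r) / (1 + r))) = (e * (r' - r)) * (r / (1 + r)) by ring.
rewrite ler_piMr ?mulr_ge0 ?subr_ge0// ler_pdivrMr// mul1r lerDr//.
Qed.

Lemma measurable_cutoff e : measurable_fun setT (cutoff e).
Proof.
apply: measurable_maxr; first exact: measurable_cst.
apply: measurable_funB; first exact: measurable_cst.
apply: measurable_funM; first exact: measurable_cst.
apply: measurableT_comp; first exact: measurable_ln.
by apply: measurable_funD; [exact: measurable_cst|exact: measurable_id].
Qed.

Lemma cvg_cutoff r : 0 <= r -> (fun k => cutoff k.+1%:R^-1 r) @ \oo --> (1 : R).
Proof.
move=> r0.
apply: (@squeeze_cvgr _ _ _ _ (fun k : nat => 1 - k.+1%:R^-1 * ln (1 + r)) (cst 1)).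
- apply: nearW => k; rewrite cutoff_le1// ?invr_ge0// andbT.
  by rewrite /cutoff le_max lexx orbT.
- rewrite -[X in _ --> X](subr0 1) -[X in _ --> _ - X](mul0r (ln (1 + r))).
  apply: cvgB; first exact: cvg_cst.
  by apply: cvgMl; exact: cvg_harmonic.
- exact: cvg_cst.
Qed.

(** Of the two product rule splittings, the one used pairs the increment of the cutoff with the
    value at the smaller radius, because [cutoff_slope] controls that increment times the smaller
    radius. *)
Lemma cutoff_lipschitz e lam (d d' r r' q : R) : 0 <= e -> 0 <= lam ->
  0 <= r -> 0 <= r' -> `|d - d'| <= lam * q -> `|d| <= lam * r -> `|d'| <= lam * r' ->
  `|r - r'| <= q ->
  cutoff e r * d - cutoff e r' * d' <= lam * (1 + e) * q.
Proof.
wlog rr' : d d' r r' / r <= r'.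
  move=> H; have [rr'|rr'] := orP (le_total r r'); first exact: H.
  move=> e0 lam0 r0 r'0 dd dr dr' rq.
  (* Negating both values and exchanging the two points leaves the difference to be bounded
     unchanged. *)
  have := H (- d') (- d) r' r rr' e0 lam0 r'0 r0.
  rewrite !normrN opprK (addrC (- d')) (distrC r') => /(_ dd dr' dr rq).
  by rewrite !mulrN opprK addrC.
move=> e0 lam0 r0 r'0 dd dr dr' rq.
have q0 : 0 <= q by apply: le_trans rq.
have -> : cutoff e r * d - cutoff e r' * d' =
  cutoff e r' * (d - d') + (cutoff e r - cutoff e r') * d by ring.
have -> : lam * (1 + e) * q = lam * q + lam * (e * q) by ring.
apply: lerD.
  apply: (@le_trans _ _ (cutoff e r' * (lam * q))).
    by apply: ler_wpM2l; [exact: cutoff_ge0|exact: le_trans (ler_norm _) dd].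
  by rewrite ler_piMl// ?mulr_ge0// cutoff_le1.
have c0 : 0 <= cutoff e r - cutoff e r' by rewrite subr_ge0 cutoff_le// r0.
apply: (@le_trans _ _ ((cutoff e r - cutoff e r') * (lam * r))).
  by apply: ler_wpM2l => //; exact: le_trans (ler_norm _) dr.
have -> : (cutoff e r - cutoff e r') * (lam * r) = lam * (r * (cutoff e r - cutoff e r')) by ring.
apply: ler_wpM2l => //; apply: (le_trans (cutoff_slope _ _ _ e0 _)); first by rewrite r0.
by apply: ler_wpM2l => //; rewrite distrC in rq; exact: le_trans (ler_norm _) rq.
Qed.

End cutoff.

(** * Passage from bounded losses to an arbitrary Lipschitz loss *)

Theorem theorem1
  (R : realType)
  (* data space *)
  (dZ : measure_display) (Z : measurableType dZ)
  (* metric hypothesis space (W, rho) *)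
  (dW : measure_display) (Wsp : measurableType dW) (rho : Wsp -> Wsp -> R)
  (rho_self : forall w, rho w w = 0)
  (rho_sep : forall w w', rho w w' = 0 -> w = w')
  (rho_sym : forall w w', rho w w' = rho w' w)
  (rho_tri : forall w1 w2 w3, rho w1 w3 <= rho w1 w2 + rho w2 w3)
  (rho_meas : measurable_fun setT (fun p : Wsp * Wsp => rho p.1 p.2))
  (* loss, lambda-Lipschitz in its first argument *)
  (loss : Wsp -> Z -> R)
  (loss_meas : measurable_fun setT (fun p : Wsp * Z => loss p.1 p.2))
  (lam : R) (lam_ge0 : 0 <= lam)
  (loss_lip : forall w w' z, `|loss w z - loss w' z| <= lam * rho w w')
  (* depth and branching factors *)
  (L : nat) (L_ge1 : (1 <= L)%N)
  (n : nat -> nat) (n_ge1 : forall k, (1 <= k <= L)%N -> (1 <= n k)%N)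
  (* meta-distribution D in P_0 *)
  (D : Lt R Z L)
  (* the learning algorithm: a Markov kernel from the (selected) tree to W *)
  (K : R.-pker (TreeM R Z L n) ~> Wsp)
  (* underlying probability space carrying the supersample, U and W *)
  (dO : measure_display) (Om : measurableType dO) (P : probability Om R)
  (MT : forall h : nat, nat -> bool -> Om -> Lt R Z h)
  (U : nat -> nat -> Om -> bool)
  (W : Om -> Wsp)
  (MT_meas : forall h j b, relevant L n h j -> measurable_fun setT (MT h j b))
  (U_meas : forall h j, relevant L n h j -> measurable_fun setT (U h j))
  (W_meas : measurable_fun setT W)
  (* joint law of the supersample and of the selection variables *)
  (law_tree : forall (A : forall h : nat, nat -> bool -> set (Lt R Z h))
       (u : nat -> nat -> bool),
     (forall h j b, relevant L n h j -> measurable (A h j b)) ->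
     P (rectE L n MT U A u) =
       (((2^-1 : R) ^+ nnodes L n)%:E * @Grect R dZ Z L n A u L 0 D)%E)
  (* W is drawn from K applied to the selected tree *)
  (law_W : forall (A : forall h : nat, nat -> bool -> set (Lt R Z h))
       (u : nat -> nat -> bool) (B : set Wsp),
     (forall h j b, relevant L n h j -> measurable (A h j b)) -> measurable B ->
     P (rectE L n MT U A u `&` W @^-1` B) =
       (\int[P]_(om in rectE L n MT U A u) K (selT MT U om) B)%E)
  (* the conditional laws P_{W | mu~, U} and P_{W | mu~} at every node *)
  (kU : forall h : nat, nat -> R.-pker ((Lt R Z h * Lt R Z h) * bool)%type ~> Wsp)
  (k0 : forall h : nat, nat -> R.-pker (Lt R Z h * Lt R Z h)%type ~> Wsp)
  (kU_cond : forall h j, relevant L n h j ->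
     forall (A : set ((Lt R Z h * Lt R Z h) * bool)%type) (B : set Wsp),
     measurable A -> measurable B ->
     P ([set om | A ((MT h j false om, MT h j true om), U h j om)] `&` W @^-1` B) =
     (\int[P]_(om in [set om | A ((MT h j false om, MT h j true om), U h j om)])
        kU h j ((MT h j false om, MT h j true om), U h j om) B)%E)
  (k0_cond : forall h j, relevant L n h j ->
     forall (A : set (Lt R Z h * Lt R Z h)%type) (B : set Wsp),
     measurable A -> measurable B ->
     P ([set om | A (MT h j false om, MT h j true om)] `&` W @^-1` B) =
     (\int[P]_(om in [set om | A (MT h j false om, MT h j true om)])
        k0 h j (MT h j false om, MT h j true om) B)%E)
  (* well-definedness: L(w) and gen(P_{W|mu}) exist *)
  (Lpop_fin : forall w, (Ehier D (fun z => (`|loss w z|)%:E) < +oo)%E)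
  (gen_int : P.-integrable setT
     (fun om => (Lpop D loss (W om) - (Lhat L n loss (W om) (selT MT U om))%:E)%E)) :
  (\int[P]_om (Lpop D loss (W om) - (Lhat L n loss (W om) (selT MT U om))%:E)
   <= (2 * lam)%:E *
      \sum_(h < L) (((Nl n (L - h))%:R^-1 : R)%:E *
        \sum_(j < Nl n (L - h))
          `| \int[P]_om wass1 rho
                 (kU h j ((MT h j false om, MT h j true om), U h j om))
                 (k0 h j (MT h j false om, MT h j true om)) |))%E.
Proof.
have rho_ge0 w w' : 0 <= rho w w'.
  by have := rho_tri w w' w; rewrite rho_self (rho_sym w') -mulr2n pmulrn_lge0.
have N0 : (Nl n L)%:R != 0 :> R.
  rewrite pnatr_eq0 -lt0n /Nl big_nat_cond; apply: prodn_cond_gt0 => k.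
  by rewrite andbT => kL; exact: n_ge1.
have leaf0 : (0 < Nl n L)%N by rewrite lt0n -(pnatr_eq0 R).
pose leaf j om : Z := selT MT U om 0%N j.
have leafE (f : Z -> \bar R) j : measurable_fun setT f ->
    (Ehier D (abse \o f) < +oo)%E -> (j < Nl n L)%N ->
    P.-integrable setT (f \o leaf j) /\ (\int[P]_om f (leaf j om) = Ehier D f)%E.
  move=> mf ff jN; split.
    exact: (integrable_leaf L n n_ge1 D K P MT U W MT_meas U_meas W_meas law_tree law_W f mf ff).
  exact: (integral_leaf L n n_ge1 D K P MT U W MT_meas U_meas W_meas law_tree law_W f mf ff).
have mlossZ w : measurable_fun setT (fun z => (loss w z)%:E).
  by apply/measurable_EFinP; exact: (measurable_fun_pair2 w loss_meas).
have leaf_loss w j : (j < Nl n L)%N ->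
    P.-integrable setT (fun om => (loss w (leaf j om))%:E) /\
    (\int[P]_om (loss w (leaf j om))%:E = Lpop D loss w)%E.
  move=> jN; apply: (leafE (fun z => (loss w z)%:E)) => //; exact: Lpop_fin.
pose lp w : R := fine (Lpop D loss w).
have lpE w : (Lpop D loss w = (lp w)%:E)%E.
  rewrite fineK//; have [fi <-] := leaf_loss w 0%N leaf0.
  exact: integrable_fin_num.
pose sel om := selT MT U om.
pose G om : R := lp (W om) - Lhat L n loss (W om) (sel om).
pose w0 : Wsp := point.
(* For the fixed hypothesis [w0] the gap has mean zero, so recentring the loss does not change the
   expected gap. *)
pose G0 om : R := lp w0 - Lhat L n loss w0 (sel om).
have GE om : (Lpop D loss (W om) - (Lhat L n loss (W om) (selT MT U om))%:E = (G om)%:E)%E.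
  by rewrite lpE -EFinB.
have G_int : P.-integrable setT (EFin \o G).
  by move: gen_int; congr (P.-integrable _ _); apply/funext => om; rewrite GE.
have LhatE w om : (Lhat L n loss w (sel om))%:E =
    (((Nl n L)%:R^-1)%:E * \sum_(j < Nl n L) (loss w (leaf j om))%:E)%E.
  by rewrite sumEFin -EFinM.
have Lhat_int w : P.-integrable setT (fun om => (Lhat L n loss w (sel om))%:E).
  under eq_fun do rewrite LhatE.
  apply: integrableZl => //; apply: integrable_sum => // j _.
  by have [] := leaf_loss w j (ltn_ord j).
have Lhat_E w : (\int[P]_om (Lhat L n loss w (sel om))%:E = (lp w)%:E)%E.
  under eq_integral do rewrite LhatE.
  have lj j : P.-integrable setT (fun om => (loss w (leaf (j : 'I_(Nl n L)) om))%:E).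
    by have [] := leaf_loss w j (ltn_ord j).
  rewrite integralZl//; last exact: integrable_sum.
  rewrite integral_sum//; under eq_bigr => j _.
    have [_ ->] := leaf_loss w j (ltn_ord j); rewrite lpE; over.
  by rewrite sumEFin -EFinM sumr_const card_ord -[lp w *+ _]mulr_natl mulKf.
have cst_int (a : R) : P.-integrable setT (EFin \o cst a).
  exact: finite_measure_integrable_cst.
have cst_E (a : R) : (\int[P]_om (EFin \o cst a) om = a%:E)%E.
  transitivity (\int[P]_om cst a%:E om)%E; first by [].
  by rewrite integral_cst// [X in (_ * X)%E]probability_setT mule1.
have G0_int : P.-integrable setT (EFin \o G0).
  by apply: (integrableB measurableT (cst_int (lp w0)) (Lhat_int w0)).
have G0_E : (\int[P]_om (G0 om)%:E = 0)%E.
  transitivity (\int[P]_om ((EFin \o cst (lp w0)) om - (Lhat L n loss w0 (sel om))%:E))%E.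
    by apply: eq_integral => om _; rewrite /G0 EFinB.
  rewrite (integralB measurableT (cst_int (lp w0)) (Lhat_int w0)) Lhat_E.
  by rewrite cst_E subee.
pose r w := rho w w0.
have r_ge0 w : 0 <= r w by exact: rho_ge0.
have mr : measurable_fun setT r by exact: (measurable_fun_pair1 w0 rho_meas).
have r_lip w w' : `|r w - r w'| <= rho w w'.
  rewrite ler_norml lerBlDr lerNl opprB lerBlDr.
  by rewrite rho_tri andbT (rho_sym w) rho_tri.
pose e k : R := k.+1%:R^-1.
have e_gt0 k : 0 < e k by rewrite invr_gt0.
pose M k : R := lam * expR (e k)^-1.
(* By [cutoff_mul_le], the product is at most [M k] in absolute value. Adding [M k] makes the loss
   nonnegative and cancels in the gap. *)
pose lk k w z : R := cutoff (e k) (r w) * (loss w z - loss w0 z) + M k.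
have lk_meas k : measurable_fun setT (fun p : Wsp * Z => lk k p.1 p.2).
  apply: measurable_funD; last exact: measurable_cst.
  apply: measurable_funM.
    exact: measurableT_comp (measurable_cutoff _) (measurableT_comp mr measurable_fst).
  apply: measurable_funB => //.
  exact: measurableT_comp (measurable_fun_pair2 w0 loss_meas) measurable_snd.
have lk_bound k w z : 0 <= lk k w z <= M k + M k.
  have : `|cutoff (e k) (r w) * (loss w z - loss w0 z)| <= M k.
    rewrite normrM ger0_norm ?cutoff_ge0//.
    apply: (@le_trans _ _ (cutoff (e k) (r w) * (lam * r w))).
      by apply: ler_wpM2l; [exact: cutoff_ge0|exact: loss_lip].
    by rewrite mulrCA ler_wpM2l// cutoff_mul_le.
  by rewrite /lk ler_norml => /andP[? ?]; apply/andP; split; lra.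
pose c k := lam * (1 + e k).
have c_ge0 k : 0 <= c k by rewrite mulr_ge0// addr_ge0// ltW.
have lk_lip k w w' z : lk k w z <= lk k w' z + c k * rho w w'.
  rewrite -lerBlDl /lk opprD addrACA subrr addr0.
  apply: cutoff_lipschitz => //; first exact: ltW.
  by rewrite opprB addrA subrK; exact: loss_lip.
have lk_Lhat k w om : Lhat L n (lk k) w (sel om) =
    cutoff (e k) (r w) * (Lhat L n loss w (sel om) - Lhat L n loss w0 (sel om)) + M k.
  rewrite /Lhat /lk big_split/= -mulr_sumr sumrB sumr_const card_ord mulrDr.
  rewrite -[M k *+ _]mulr_natl mulKf//; congr (_ + _).
  by rewrite mulrCA mulrBr.
have lk_Lpop k w : (Lpop D (lk k) w =
    (cutoff (e k) (r w) * (lp w - lp w0) + M k)%:E)%E.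
  have mlk : measurable_fun setT (fun z => (lk k w z)%:E).
    by apply/measurable_EFinP; exact: (measurable_fun_pair2 w (lk_meas k)).
  have lk_fin : (Ehier D (abse \o (fun z => (lk k w z)%:E)) < +oo)%E.
    apply: (@le_lt_trans _ _ (M k + M k)%:E); last by rewrite ltry.
    rewrite -[leRHS](Ehier_cst L D); apply: le_Ehier => z; first exact: abse_ge0.
    by rewrite /= lee_fin ger0_norm; have /andP[] := lk_bound k w z.
  (* Linearity of the nested integral in a signed loss is read off a single integral over [Om], that
     of leaf 0. *)
  rewrite /Lpop; have [_ <-] := leafE _ 0%N mlk lk_fin leaf0.
  have [i1 E1] := leaf_loss w 0%N leaf0; have [i0 E0] := leaf_loss w0 0%N leaf0.
  transitivity (\int[P]_om ((cutoff (e k) (r w))%:E *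
      ((loss w (leaf 0%N om))%:E - (loss w0 (leaf 0%N om))%:E) + (EFin \o cst (M k)) om))%E.
    by apply: eq_integral => om _; rewrite /lk EFinD EFinM EFinB.
  rewrite (integralD measurableT (integrableZl measurableT _ (integrableB measurableT i1 i0))
    (cst_int (M k))).
  rewrite (integralZl measurableT (integrableB measurableT i1 i0)).
  rewrite (integralB measurableT i1 i0) E1 E0 !lpE.
  by rewrite cst_E.
(* By [lk_Lpop] and [lk_Lhat], this is the expected gap for the loss [lk k]. *)
pose u k := (\int[P]_om (cutoff (e k) (r (W om)) * (G om - G0 om))%:E)%E.
set S := (X in (_ <= _ * X)%E).
have u_le k : (u k <= (2 * c k)%:E * S)%E.
  rewrite /u; have := bounded_gap_le rho rho_meas rho_ge0 rho_sym L n n_ge1 D K P MT U W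
    MT_meas U_meas W_meas law_tree law_W kU k0 kU_cond (lk k) (c k) (M k + M k)
    (lk_meas k) (lk_bound k) (c_ge0 k) (lk_lip k) L_ge1.
  apply: le_trans; rewrite le_eqVlt; apply/orP; left; apply/eqP.
  apply: eq_integral => om _; rewrite lk_Lpop lk_Lhat -EFinB; congr EFin.
  rewrite /G /G0; ring.
have u_cvg : u @ \oo --> (\int[P]_om (G om)%:E)%E.
  have -> : (\int[P]_om (G om)%:E = \int[P]_om (G om - G0 om)%:E)%E.
    transitivity (\int[P]_om ((EFin \o G) om - (EFin \o G0) om))%E; last first.
      by apply: eq_integral => om _; rewrite /= EFinB.
    by rewrite (integralB measurableT G_int G0_int) [X in (_ = _ - X)%E]G0_E sube0.
  have mG : measurable_fun setT (fun om => G om - G0 om).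
    by apply: measurable_funB; apply/measurable_EFinP; exact: (measurable_int P).
  have GG_int : P.-integrable setT (fun om => (G om - G0 om)%:E).
    by apply: (integrableB measurableT G_int G0_int).
  have [] // := @dominated_convergence _ _ _ P setT measurableT
    (fun k om => (cutoff (e k) (r (W om)) * (G om - G0 om))%:E)
    (fun om => (G om - G0 om)%:E) (fun om => `|(G om - G0 om)%:E|%E).
  - move=> k; apply/measurable_EFinP; apply: measurable_funM => //.
    exact: measurableT_comp (measurable_cutoff _) (measurableT_comp mr W_meas).
  - exact/measurable_EFinP.
  - apply: aeW => om _; apply: cvg_EFin; first by apply: nearW.
    rewrite -[X in _ --> X]mul1r; apply: cvgMl; exact: cvg_cutoff.
  - exact: integrable_abse.
  - apply: aeW => om k _; rewrite lee_fin normrM ler_piMl//.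
    by rewrite ger0_norm ?cutoff_ge0// cutoff_le1// ltW.
under eq_integral do rewrite GE.
have S_ge0 : (0 <= S)%E.
  apply: sume_ge0 => h _; rewrite mule_ge0 ?lee_fin ?invr_ge0 ?ler0n//.
  by apply: sume_ge0 => j _; exact: abse_ge0.
(* An infinite bound is trivial; a finite one lets the factor 1 + e k tend to 1 within the reals. *)
have [Tfin|Tinf] := boolP (((2 * lam)%:E * S)%E \is a fin_num); last first.
  have T0 : (0 <= (2 * lam)%:E * S)%E by rewrite mule_ge0// lee_fin mulr_ge0.
  by move: Tinf; rewrite ge0_fin_numE// -leNgt leye_eq => /eqP ->; rewrite leey.
pose t := fine ((2 * lam)%:E * S)%E.
have tE : ((2 * lam)%:E * S = t%:E)%E by rewrite fineK.
rewrite tE; apply: (lee_cvg_to u_cvg (g := fun k => ((1 + e k) * t)%:E)).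
  apply: cvg_EFin; first by apply: nearW.
  rewrite -[X in _ --> X]mul1r; apply: cvgMl.
  by rewrite -[X in _ --> X]addr0; apply: cvgD; [exact: cvg_cst|exact: cvg_harmonic].
apply: nearW => k; apply: le_trans (u_le k) _.
rewrite [leRHS]EFinM -tE muleA -EFinM (_ : 2 * c k = (1 + e k) * (2 * lam))//.
by rewrite /c; ring.
Qed.
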